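(* Let $\mathbf{k}$ be an algebraically closed field of characteristic zero, $\mathbf{k}^*=\mathbf{k}\setminus\{0\}$, $t$ an indeterminate and $n\ge1$. Let $A_n$ be the $\mathbf{k}[t]$-algebra generated by $x_1,\ldots,x_{2n}$ subject to the relations, for $j>i$: $x_jx_i=x_ix_j+t$ if $j=2\ell$, $i=2\ell-1$ for some $\ell$, and $x_jx_i=x_ix_j$ otherwise. (1) For each $q\in\mathbf{k}^*$, let $A_q:=A_n/(t-q)A_n$. Then $A_q$ is the $\mathbf{k}$-algebra generated by $x_1,\ldots,x_{2n}$ subject to the relations, for $j>i$, $$x_jx_i-x_ix_j=\begin{cases}q,&\text{if } j=2\ell,\ i=2\ell-1 \text{ for some } \ell,\\ 0,&\text{otherwise,}\end{cases}$$ which is an iterated skew polynomial $\mathbf{k}$-algebra $$A_q=\mathbf{k}[x_1][x_2;\nu_2']\ldots[x_{2n-1}][x_{2n};\nu_{2n}'],$$ where the $\mathbf{k}$-linear map $\nu'_{2j}$ is the derivation defined by $\nu'_{2j}(x_i)=q$ if $i=2j-1$ and $\nu'_{2j}(x_i)=0$ otherwise; namely $\nu'_{2j}=q\frac{\partial}{\partial x_{2j-1}}$. (2) For each $q\in\mathbf{k}^*$, $A_q\cong W_n$ as $\mathbf{k}$-algebras, where $W_n$ is the $n$-th Weyl algebra. In particular, if $q=1$ then $A_q=W_n$. (3) The set of all standard monomials in $x_1,x_2,\ldots,x_{2n}$ including the unity $1$ is a $\mathbf{k}[t]$-basis of $A_n$ and a $\mathbf{k}$-basis of $A_q$, $W_n$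 and $B_n$ for each $q\in\mathbf{k}^*$, where $B_n$ is the $n$-th Poisson Weyl algebra.
   Context: All algebras are associative and unital. The $n$-th Weyl algebra $W_n$ is the $\mathbf{k}$-algebra generated by $x_1,\ldots,x_{2n}$ subject to the relations, for $j>i$: $x_jx_i-x_ix_j=1$ if $j=2\ell$, $i=2\ell-1$ for some $\ell$, and $0$ otherwise. The $n$-th Poisson Weyl algebra $B_n$ is the commutative polynomial algebra $\mathbf{k}[x_1,\ldots,x_{2n}]$ with the Poisson bracket $\{f,g\}=\sum_{i=1}^n\left(-\frac{\partial f}{\partial x_{2i-1}}\frac{\partial g}{\partial x_{2i}}+\frac{\partial g}{\partial x_{2i-1}}\frac{\partial f}{\partial x_{2i}}\right)$. A monomial $x_{i_1}\cdots x_{i_k}$ (a finite product of the generators) is standard if $1\le i_1\le\cdots\le i_k\le 2n$. For an algebra $R$ over a commutative ring $S$ and an $S$-linear derivation $\nu$ on $R$, $R[z;\nu]$ denotes the skew polynomial $S$-algebra, which is a free left $R$-module with basis $\{z^i\}_{i\ge0}$ and multiplication determined by $za=az+\nu(a)$ for $a\in R$; $R[z]$ is the case $\nu=0$. *)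

(* Defs.v *)
From HB Require Import structures.
From mathcomp.multinomials Require Import monalg mpoly.
From mathcomp Require Import all_boot all_order all_algebra boolp ring.

Set Implicit Arguments.
Unset Strict Implicit.
Unset Printing Implicit Defensive.

Import GRing.Theory.

Local Open Scope ring_scope.
Local Open Scope quotient_scope.

(* In MathComp an [algType] is a nonzero ring, so only quotients by proper
   two-sided ideals are formed. *)
Record proper_ideal2 (R : nzRingType) := ProperIdeal2 {
  mem_ideal2 :> R -> Prop;
  ideal2_0 : mem_ideal2 0;
  ideal2_B : forall a b, mem_ideal2 a -> mem_ideal2 b -> mem_ideal2 (a - b);
  ideal2_Ml : forall r a, mem_ideal2 a -> mem_ideal2 (r * a);
  ideal2_Mr : forall r a, mem_ideal2 a -> mem_ideal2 (a * r);
  ideal2_proper : ~ mem_ideal2 1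
}.

Section QuotientRing.
Variables (R : nzRingType) (I : proper_ideal2 R).

Definition ideal2_eq (a b : R) : bool := `[< I (a - b) >].

Lemma ideal2_eqP a b : reflect (I (a - b)) (ideal2_eq a b).
Proof. exact: asboolP. Qed.

Lemma ideal2_N a : I a -> I (- a).
Proof. by move=> Ia; rewrite -sub0r; apply: ideal2_B => //; apply: ideal2_0. Qed.

Lemma ideal2_D a b : I a -> I b -> I (a + b).
Proof. by move=> Ia Ib; rewrite -[b]opprK; apply/ideal2_B/ideal2_N. Qed.

Lemma ideal2_eq_refl : reflexive ideal2_eq.
Proof. by move=> a; apply/ideal2_eqP; rewrite subrr; apply: ideal2_0. Qed.

Lemma ideal2_eq_sym : symmetric ideal2_eq.
Proof.
by move=> a b; apply/ideal2_eqP/ideal2_eqP => /ideal2_N; rewrite opprB.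
Qed.

Lemma ideal2_eq_trans : transitive ideal2_eq.
Proof.
move=> b a c /ideal2_eqP Iab /ideal2_eqP Ibc; apply/ideal2_eqP.
by rewrite -(subrKA b); apply: ideal2_D.
Qed.

Canonical ideal2_equiv :=
  EquivRel ideal2_eq ideal2_eq_refl ideal2_eq_sym ideal2_eq_trans.

Definition quot_alg : Type := {eq_quot ideal2_equiv}.

HB.instance Definition _ : EqQuotient R ideal2_equiv quot_alg :=
  EqQuotient.on quot_alg.
HB.instance Definition _ := Choice.on quot_alg.

Definition quot_proj (a : R) : quot_alg := \pi a.

Lemma quot_projP (a b : R) : quot_proj a = quot_proj b <-> I (a - b).
Proof.
split; first by move/eqP; rewrite /quot_proj piE => /ideal2_eqP.
by move=> Iab; apply/eqP; rewrite /quot_proj piE; apply/ideal2_eqP.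
Qed.

Lemma quot_proj_surj (x : quot_alg) : exists a, x = quot_proj a.
Proof. by exists (repr x); rewrite /quot_proj reprK. Qed.

Definition quot_add (x y : quot_alg) := quot_proj (repr x + repr y).
Definition quot_opp (x : quot_alg) := quot_proj (- repr x).
Definition quot_mul (x y : quot_alg) := quot_proj (repr x * repr y).

Lemma repr_quot_proj (a : R) : I (repr (quot_proj a) - a).
Proof. by apply/quot_projP; rewrite /quot_proj reprK. Qed.

Lemma quot_addE a b :
  quot_add (quot_proj a) (quot_proj b) = quot_proj (a + b).
Proof.
apply/quot_projP; rewrite opprD addrACA.
by apply: ideal2_D; apply: repr_quot_proj.
Qed.

Lemma quot_oppE a : quot_opp (quot_proj a) = quot_proj (- a).
Proof. by apply/quot_projP; rewrite -opprD; apply/ideal2_N/repr_quot_proj. Qed.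

Lemma quot_mulE a b :
  quot_mul (quot_proj a) (quot_proj b) = quot_proj (a * b).
Proof.
apply/quot_projP; rewrite -(subrKA (a * repr (quot_proj b))).
rewrite -mulrBl -mulrBr; apply: ideal2_D.
  exact/ideal2_Mr/repr_quot_proj.
exact/ideal2_Ml/repr_quot_proj.
Qed.

Fact quot_addA : associative quot_add.
Proof.
move=> x y z; have [a ->] := quot_proj_surj x; have [b ->] := quot_proj_surj y.
have [c ->] := quot_proj_surj z.
by rewrite (quot_addE b c) (quot_addE a b) (quot_addE a) quot_addE addrA.
Qed.
Fact quot_addC : commutative quot_add.
Proof.
move=> x y; have [a ->] := quot_proj_surj x; have [b ->] := quot_proj_surj y.
by rewrite (quot_addE a b) (quot_addE b a) addrC.
Qed.
Fact quot_add0 : left_id (quot_proj 0) quot_add.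
Proof. by move=> x; have [a ->] := quot_proj_surj x; rewrite quot_addE add0r. Qed.
Fact quot_addN : left_inverse (quot_proj 0) quot_opp quot_add.
Proof.
move=> x; have [a ->] := quot_proj_surj x.
by rewrite (quot_oppE a) quot_addE addNr.
Qed.

HB.instance Definition _ :=
  GRing.isZmodule.Build quot_alg quot_addA quot_addC quot_add0 quot_addN.

Fact quot_mulA : associative quot_mul.
Proof.
move=> x y z; have [a ->] := quot_proj_surj x; have [b ->] := quot_proj_surj y.
have [c ->] := quot_proj_surj z.
by rewrite (quot_mulE b c) (quot_mulE a b) (quot_mulE a) quot_mulE mulrA.
Qed.
Fact quot_mul1l : left_id (quot_proj 1) quot_mul.
Proof. by move=> x; have [a ->] := quot_proj_surj x; rewrite quot_mulE mul1r. Qed.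
Fact quot_mul1r : right_id (quot_proj 1) quot_mul.
Proof. by move=> x; have [a ->] := quot_proj_surj x; rewrite quot_mulE mulr1. Qed.
Fact quot_mulDl : left_distributive quot_mul quot_add.
Proof.
move=> x y z; have [a ->] := quot_proj_surj x; have [b ->] := quot_proj_surj y.
have [c ->] := quot_proj_surj z.
rewrite (quot_addE a b) (quot_mulE a c) (quot_mulE b c) quot_mulE quot_addE.
by rewrite mulrDl.
Qed.
Fact quot_mulDr : right_distributive quot_mul quot_add.
Proof.
move=> x y z; have [a ->] := quot_proj_surj x; have [b ->] := quot_proj_surj y.
have [c ->] := quot_proj_surj z.
rewrite (quot_addE b c) (quot_mulE a b) (quot_mulE a c) quot_mulE quot_addE.
by rewrite mulrDr.
Qed.
Fact quot_1neq0 : quot_proj 1 != quot_proj 0.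
Proof. by apply/eqP => /quot_projP; rewrite subr0; apply: ideal2_proper. Qed.

HB.instance Definition _ := GRing.Zmodule_isNzRing.Build quot_alg
  quot_mulA quot_mul1l quot_mul1r quot_mulDl quot_mulDr quot_1neq0.

Fact quot_proj_zmod_morphism : zmod_morphism quot_proj.
Proof. by move=> a b; rewrite -quot_addE -quot_oppE. Qed.
Fact quot_proj_monoid_morphism : monoid_morphism quot_proj.
Proof. by split=> // a b; rewrite -quot_mulE. Qed.

HB.instance Definition _ :=
  GRing.isZmodMorphism.Build R quot_alg quot_proj quot_proj_zmod_morphism.
HB.instance Definition _ :=
  GRing.isMonoidMorphism.Build R quot_alg quot_proj quot_proj_monoid_morphism.

End QuotientRing.

Section QuotientAlgebra.
Variables (S : comNzRingType) (R : algType S) (I : proper_ideal2 R).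
Local Notation Q := (quot_alg I).
Local Notation pr := (@quot_proj R I).

Definition quot_scale (c : S) (x : Q) : Q := pr (c *: repr x).

Lemma quot_scaleE c (a : R) : quot_scale c (pr a) = pr (c *: a).
Proof.
apply/quot_projP; rewrite -scalerBr -mulr_algl.
exact/ideal2_Ml/repr_quot_proj.
Qed.

Fact quot_scaleA c d x : quot_scale c (quot_scale d x) = quot_scale (c * d) x.
Proof.
have [a ->] := quot_proj_surj x.
by rewrite (quot_scaleE d a) (quot_scaleE c) (quot_scaleE (c * d)) scalerA.
Qed.
Fact quot_scale1 : left_id 1 quot_scale.
Proof.
by move=> x; have [a ->] := quot_proj_surj x; rewrite quot_scaleE scale1r.
Qed.
Fact quot_scaleDr : right_distributive quot_scale +%R.
Proof.
move=> c x y; have [a ->] := quot_proj_surj x; have [b ->] := quot_proj_surj y.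
rewrite -rmorphD (quot_scaleE c (a + b)) (quot_scaleE c a) (quot_scaleE c b).
by rewrite scalerDr rmorphD.
Qed.
Fact quot_scaleDl x : {morph quot_scale^~ x : c d / c + d}.
Proof.
move=> c d; have [a ->] := quot_proj_surj x.
rewrite (quot_scaleE (c + d)) (quot_scaleE c) (quot_scaleE d).
by rewrite scalerDl rmorphD.
Qed.

HB.instance Definition _ := GRing.Zmodule_isLmodule.Build S Q
  quot_scaleA quot_scale1 quot_scaleDr quot_scaleDl.

Fact quot_proj_scalable : scalable pr.
Proof. by move=> c a; rewrite -quot_scaleE. Qed.

Fact quot_scaleAl (c : S) (x y : Q) : c *: (x * y) = (c *: x) * y.
Proof.
have [a ->] := quot_proj_surj x; have [b ->] := quot_proj_surj y.
by rewrite -(quot_proj_scalable c a) -!rmorphM -quot_proj_scalable scalerAl.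
Qed.
Fact quot_scaleAr (c : S) (x y : Q) : c *: (x * y) = x * (c *: y).
Proof.
have [a ->] := quot_proj_surj x; have [b ->] := quot_proj_surj y.
by rewrite -(quot_proj_scalable c b) -!rmorphM -quot_proj_scalable scalerAr.
Qed.

HB.instance Definition _ := GRing.Lmodule_isLalgebra.Build S Q quot_scaleAl.
HB.instance Definition _ := GRing.Lalgebra_isAlgebra.Build S Q quot_scaleAr.
HB.instance Definition _ :=
  GRing.isScalable.Build S R Q *:%R pr quot_proj_scalable.

End QuotientAlgebra.

Section RestrictScalars.
Variables (S T : comNzRingType) (h : {rmorphism S -> T}) (A : algType T).

Definition restrict_scalars : Type := let _ := h in A.
Local Notation B := restrict_scalars.
HB.instance Definition _ := GRing.NzRing.on B.

Definition restr_scale (c : S) (a : B) : B := h c *: (a : A).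

Fact restr_scaleA c d x :
  restr_scale c (restr_scale d x) = restr_scale (c * d) x.
Proof. by rewrite /restr_scale scalerA rmorphM. Qed.
Fact restr_scale1 : left_id 1 restr_scale.
Proof. by move=> x; rewrite /restr_scale rmorph1 scale1r. Qed.
Fact restr_scaleDr : right_distributive restr_scale +%R.
Proof. by move=> c x y; rewrite /restr_scale scalerDr. Qed.
Fact restr_scaleDl x : {morph restr_scale^~ x : c d / c + d}.
Proof. by move=> c d; rewrite /restr_scale rmorphD scalerDl. Qed.
HB.instance Definition _ := GRing.Zmodule_isLmodule.Build S B
  restr_scaleA restr_scale1 restr_scaleDr restr_scaleDl.

Fact restr_scaleAl (c : S) (x y : B) : c *: (x * y) = (c *: x) * y.
Proof. exact: (scalerAl (h c) (x : A)). Qed.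
Fact restr_scaleAr (c : S) (x y : B) : c *: (x * y) = x * (c *: y).
Proof. exact: (scalerAr (h c) (x : A)). Qed.
HB.instance Definition _ := GRing.Lmodule_isLalgebra.Build S B restr_scaleAl.
HB.instance Definition _ := GRing.Lalgebra_isAlgebra.Build S B restr_scaleAr.

End RestrictScalars.

Record derivation (S : comNzRingType) (R : algType S) := Derivation {
  der_fun :> {linear R -> R};
  derivation_leibniz :
    forall a b, der_fun (a * b) = der_fun a * b + a * der_fun b
}.

Section DerivationOps.
Variables (S : comNzRingType) (R : algType S).

Fact zero_derivation_leibniz (a b : R) :
  (\0 : {linear R -> R}) (a * b)
  = (\0 : {linear R -> R}) a * b + a * (\0 : {linear R -> R}) b.
Proof. by rewrite /= mul0r mulr0 addr0. Qed.

Definition zero_derivation : derivation R := Derivation zero_derivation_leibniz.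

Lemma derivation1 (nu : derivation R) : nu 1 = 0.
Proof.
have /eqP := derivation_leibniz nu 1 1.
by rewrite !mulr1 mul1r -subr_eq subrr eq_sym => /eqP.
Qed.

Lemma derivation_alg (nu : derivation R) c : nu c%:A = 0.
Proof. by rewrite linearZ /= derivation1 scaler0. Qed.

End DerivationOps.

Section SkewPoly.
Variables (S : comNzRingType) (R : algType S) (nu : derivation R).
Implicit Types (a : R) (p q r : {poly R}).

(* The coefficients of a skew polynomial are written on the left of the powers
   of the variable.  [skew_varmul q] is the product [z * q], as forced by
   [z * a = a * z + nu a]. *)
Definition skew_varmul (q : {poly R}) : {poly R} := q * 'X + map_poly nu q.

Definition skew_mul (p q : {poly R}) : {poly R} :=
  \sum_(i < size p) p`_i *: iter i skew_varmul q.

Lemma skew_varmul_coef q i :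
  (skew_varmul q)`_i = (if i == 0%N then 0 else q`_i.-1) + nu q`_i.
Proof. by rewrite coefD coefMX coef_map. Qed.

Fact skew_varmul_linear_subproof : zmod_morphism skew_varmul.
Proof. by move=> p q; rewrite /skew_varmul mulrBl raddfB /= opprD addrACA. Qed.
HB.instance Definition _ :=
  GRing.isZmodMorphism.Build {poly R} {poly R} skew_varmul
    skew_varmul_linear_subproof.

Lemma skew_varmulZ a q : skew_varmul (a *: q) = a *: skew_varmul q + nu a *: q.
Proof.
apply/polyP => i.
rewrite skew_varmul_coef !(coefD, coefZ) coefMX coef_map /=.
rewrite derivation_leibniz mulrDr [nu a * _ + _]addrC addrA.
by case: ifP => // _; rewrite mulr0.
Qed.

Lemma skew_mulE m p q : (size p <= m)%N ->
  skew_mul p q = \sum_(i < m) p`_i *: iter i skew_varmul q.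
Proof.
move=> le_pm; rewrite /skew_mul.
rewrite (big_ord_widen m (fun i => p`_i *: iter i skew_varmul q) le_pm).
rewrite big_mkcond /=.
apply: eq_bigr => i _; case: ltnP => // le_pi.
by rewrite nth_default ?scale0r.
Qed.

Lemma skew_mulDl : left_distributive skew_mul +%R.
Proof.
move=> p1 p2 q; set m := maxn (size p1) (size p2).
rewrite (@skew_mulE m) ?size_polyD // (@skew_mulE m p1) ?leq_maxl //.
rewrite (@skew_mulE m p2) ?leq_maxr // -big_split /=.
by apply: eq_bigr => i _; rewrite coefD scalerDl.
Qed.

Lemma skew_mulZl a p q : skew_mul (a *: p) q = a *: skew_mul p q.
Proof.
rewrite (@skew_mulE (size p)) ?size_scale_leq // scaler_sumr.
by apply: eq_bigr => i _; rewrite coefZ scalerA.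
Qed.

Lemma skew_mulDr : right_distributive skew_mul +%R.
Proof.
move=> p q1 q2; rewrite /skew_mul -big_split /=; apply: eq_bigr => i _.
rewrite -scalerDr; congr (_ *: _).
by elim: (i : nat) => //= j ->; rewrite raddfD.
Qed.

Lemma skew_mulC a q : skew_mul a%:P q = a *: q.
Proof. by rewrite (@skew_mulE 1%N) ?size_polyC_leq1 // big_ord1 coefC. Qed.

Lemma skew_mulMX p q : skew_mul (p * 'X) q = skew_mul p (skew_varmul q).
Proof.
rewrite (@skew_mulE (size p).+1); last first.
  by rewrite (leq_trans (size_polyMleq _ _)) // size_polyX addn2.
rewrite big_ord_recl coefMX eqxx scale0r add0r; apply: eq_bigr => i _.
by rewrite coefMX /= -iterSr.
Qed.

Lemma skew_varmulX p : skew_varmul (p * 'X) = skew_varmul p * 'X.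
Proof.
rewrite /skew_varmul mulrDl; congr (_ + _).
apply/polyP => i; rewrite coef_map !coefMX /=.
by case: ifP; rewrite ?raddf0 // coef_map.
Qed.

Lemma skew_varmulC a : skew_varmul a%:P = a *: 'X + (nu a)%:P.
Proof. by rewrite /skew_varmul mul_polyC map_polyC. Qed.

Lemma skew_varmulXn i : skew_varmul 'X^i = 'X^(i.+1).
Proof.
rewrite /skew_varmul exprSr -[RHS]addr0; congr (_ + _).
apply/polyP => j; rewrite coef_map coefXn coef0 /=.
by case: eqP => _; rewrite ?derivation1 ?raddf0.
Qed.

Lemma skew_mulX q : skew_mul 'X q = skew_varmul q.
Proof. by rewrite -['X]mul1r skew_mulMX -polyC1 skew_mulC scale1r. Qed.

Lemma skew_varmulM p q :
  skew_varmul (skew_mul p q) = skew_mul (skew_varmul p) q.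
Proof.
elim/poly_ind: p q => [|p a IHp] q.
  by rewrite /skew_mul size_poly0 big_ord0 raddf0 size_poly0 big_ord0.
rewrite skew_mulDl !raddfD /= skew_mulDl skew_mulMX IHp skew_varmulX skew_mulMX.
congr (_ + _); rewrite skew_mulC skew_varmulZ skew_varmulC skew_mulDl.
by rewrite -[a *: 'X]mul_polyC skew_mulMX !skew_mulC.
Qed.

Fact skew_mulA : associative skew_mul.
Proof.
elim/poly_ind => [|p a IHp] q r.
  rewrite -[0]/(0%:P) !skew_mulC !scale0r.
  by rewrite -[0]/(0%:P) skew_mulC scale0r.
by rewrite !skew_mulDl !skew_mulMX !skew_mulC skew_varmulM IHp skew_mulZl.
Qed.

Fact skew_mul1l : left_id 1 skew_mul.
Proof. by move=> p; rewrite -polyC1 skew_mulC scale1r. Qed.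

Fact skew_mul1r : right_id 1 skew_mul.
Proof.
move=> p; rewrite -[RHS]coefK poly_def; apply: eq_bigr => i _.
congr (_ *: _); elim: (i : nat) => [|j IHj] /=; first by rewrite expr0.
by rewrite IHj skew_varmulXn.
Qed.

Definition skew_poly : Type := let _ := nu in {poly R}.
HB.instance Definition _ := GRing.Zmodule.on skew_poly.

Fact skew_poly_1neq0 : (1 : {poly R}) != 0.
Proof. exact: oner_neq0. Qed.
HB.instance Definition _ := GRing.Zmodule_isNzRing.Build skew_poly
  skew_mulA skew_mul1l skew_mul1r skew_mulDl skew_mulDr skew_poly_1neq0.

Definition skew_scale (c : S) (p : skew_poly) : skew_poly :=
  (c%:A : R) *: (p : {poly R}).

Fact skew_scaleA c d x : skew_scale c (skew_scale d x) = skew_scale (c * d) x.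
Proof. by rewrite /skew_scale scalerA mulr_algl scalerA. Qed.
Fact skew_scale1 : left_id 1 skew_scale.
Proof. by move=> x; rewrite /skew_scale !scale1r. Qed.
Fact skew_scaleDr : right_distributive skew_scale +%R.
Proof. by move=> c x y; rewrite /skew_scale scalerDr. Qed.
Fact skew_scaleDl x : {morph skew_scale^~ x : c d / c + d}.
Proof. by move=> c d; rewrite /skew_scale !scalerDl. Qed.
HB.instance Definition _ := GRing.Zmodule_isLmodule.Build S skew_poly
  skew_scaleA skew_scale1 skew_scaleDr skew_scaleDl.

Fact skew_scaleAl (c : S) (x y : skew_poly) : c *: (x * y) = (c *: x) * y.
Proof. exact/esym/skew_mulZl. Qed.
Fact skew_scaleAr (c : S) (x y : skew_poly) : c *: (x * y) = x * (c *: y).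
Proof.
change (c%:A *: skew_mul x y = skew_mul x (c%:A *: y)).
rewrite /skew_mul scaler_sumr; apply: eq_bigr => i _.
have ->: iter i skew_varmul (c%:A *: y) = c%:A *: iter i skew_varmul y.
  elim: (i : nat) => //= j ->.
  by rewrite skew_varmulZ derivation_alg scale0r addr0.
by rewrite !scalerA mulr_algl mulr_algr.
Qed.
HB.instance Definition _ := GRing.Lmodule_isLalgebra.Build S skew_poly
  skew_scaleAl.
HB.instance Definition _ := GRing.Lalgebra_isAlgebra.Build S skew_poly
  skew_scaleAr.

Definition skew_const (a : R) : skew_poly := a%:P.
Definition skew_var : skew_poly := 'X.

Fact skew_const_zmod_morphism : zmod_morphism skew_const.
Proof. exact: raddfB. Qed.
Fact skew_const_monoid_morphism : monoid_morphism skew_const.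
Proof.
by split=> // a b; rewrite /skew_const rmorphM /= mul_polyC -skew_mulC.
Qed.
Fact skew_const_scalable : scalable skew_const.
Proof.
by move=> c a; rewrite /skew_const -mulr_algl rmorphM /= mul_polyC.
Qed.
HB.instance Definition _ := GRing.isZmodMorphism.Build R skew_poly skew_const
  skew_const_zmod_morphism.
HB.instance Definition _ := GRing.isMonoidMorphism.Build R skew_poly skew_const
  skew_const_monoid_morphism.
HB.instance Definition _ := GRing.isScalable.Build S R skew_poly *:%R skew_const
  skew_const_scalable.

Lemma skew_var_const a :
  skew_var * skew_const a = skew_const a * skew_var + skew_const (nu a).
Proof.
rewrite -[LHS]/(skew_mul 'X a%:P) -[_ * _]/(skew_mul a%:P 'X) skew_mulC.
by rewrite skew_mulX skew_varmulC.
Qed.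

Lemma skew_poly_expand (p : skew_poly) :
  p = \sum_(i < size (p : {poly R})) skew_const p`_i * skew_var ^+ i.
Proof.
have expE i : skew_var ^+ i = ('X^i : {poly R}).
  elim: i => // i IHi; rewrite exprS IHi.
  by rewrite -[LHS]/(skew_mul 'X 'X^i) skew_mulX skew_varmulXn.
rewrite -[LHS]coefK poly_def; apply: eq_bigr => i _.
by rewrite expE -[RHS]/(skew_mul _ _) skew_mulC.
Qed.

End SkewPoly.

Section Tower.
Variables (S : comNzRingType) (q : S).

Section PartialTop.
Variable R : algType S.
Local Notation Rx := (skew_poly (zero_derivation R)).

Lemma skew_mul0E (p r : {poly R}) : skew_mul (zero_derivation R) p r = p * r.
Proof.
rewrite -[in RHS](coefK p) poly_def mulr_suml; apply: eq_bigr => i _.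
rewrite -scalerAl; congr (_ *: _).
elim: (i : nat) => [|j IHj] /=; first by rewrite expr0 mul1r.
have map0 (s : {poly R}) : map_poly (zero_derivation R) s = 0.
  by apply/polyP => l; rewrite coef_map coef0.
by rewrite IHj /skew_varmul map0 addr0 exprSr -!mulrA commr_polyX.
Qed.

Definition partial_top (p : Rx) : Rx := q *: ((p : {poly R})^`() : Rx).

Fact partial_top_linear : linear partial_top.
Proof.
move=> c p r; rewrite /partial_top.
rewrite -[_ + _]/(c%:A *: (p : {poly R}) + r : {poly R}).
rewrite derivD derivZ -[_ + _]/(c *: (p^`() : Rx) + (r^`() : Rx)).
by rewrite scalerDr !scalerA mulrC.
Qed.
HB.instance Definition _ :=
  GRing.isLinear.Build S Rx Rx *:%R partial_top partial_top_linear.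

Fact partial_top_leibniz (p r : Rx) :
  partial_top (p * r) = partial_top p * r + p * partial_top r.
Proof.
rewrite /partial_top -scalerAl -scalerAr -scalerDr; congr (_ *: _).
rewrite -[p * r]/(skew_mul _ _ _) skew_mul0E derivM.
rewrite -[X in _ = X + _]/(skew_mul _ _ _) -[X in _ = _ + X]/(skew_mul _ _ _).
by rewrite !skew_mul0E.
Qed.

(* [q] times the formal partial derivative in the variable of [R[x]]. *)
Definition partial_derivation : derivation Rx :=
  @Derivation S Rx partial_top partial_top_leibniz.

Lemma partial_derivation_const a :
  partial_derivation (skew_const (zero_derivation R) a) = 0.
Proof.
by rewrite /= /partial_top -[skew_const _ _]/(a%:P) derivC scaler0.
Qed.

Lemma partial_derivation_var :
  partial_derivation (skew_var (zero_derivation R)) = q%:A.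
Proof. by rewrite /= /partial_top derivX. Qed.

End PartialTop.

(* [weyl_tower n] is [S[x_1][x_2; nu'_2]...[x_{2n-1}][x_{2n}; nu'_{2n}]] with
   [nu'_{2j} = q * d/dx_{2j-1}], and [odd_tower n] is [(weyl_tower n)[x_{2n+1}]].
   Generators are numbered from 0: index [i] stands for [x_{i+1}]. *)
Fixpoint weyl_tower (n : nat) : algType S :=
  if n is n'.+1 then skew_poly (partial_derivation (weyl_tower n')) else S^o.

Definition odd_tower (n : nat) : algType S :=
  skew_poly (zero_derivation (weyl_tower n)).

Definition tower_derivation (n : nat) : derivation (odd_tower n) :=
  partial_derivation (weyl_tower n).

Fixpoint weyl_tower_gen (n i : nat) : weyl_tower n :=
  if n is n'.+1 then
    if i == n'.*2.+1 then skew_var (tower_derivation n')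
    else skew_const (tower_derivation n')
      (if i == n'.*2 then skew_var (zero_derivation (weyl_tower n'))
       else skew_const (zero_derivation (weyl_tower n')) (weyl_tower_gen n' i))
  else 0.

Definition odd_tower_gen (n i : nat) : odd_tower n :=
  if i == n.*2 then skew_var (zero_derivation (weyl_tower n))
  else skew_const (zero_derivation (weyl_tower n)) (weyl_tower_gen n i).

End Tower.

Section FreeAlgebra.
Variables (S : comNzRingType) (m : nat).

Definition free_alg : Type := {malg S[{fmonom 'I_m}]}.
HB.instance Definition _ := GRing.Lalgebra.on free_alg.

Fact free_alg_scaleAr (c : S) (a b : free_alg) : c *: (a * b) = a * (c *: b).
Proof.
have cC : malgC c * a = a * malgC c.
  rewrite !malgM_def fgmulUg fgmulgU; apply: eq_bigr => w _.
  by rewrite mulrC mul1m mulm1.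
have scE (g : {malg S[{fmonom 'I_m}]}) : c *: g = malgC c * g.
  by rewrite mul_malgC.
by rewrite (scE (a * b)) (scE b) !mulrA cC.
Qed.
HB.instance Definition _ :=
  GRing.Lalgebra_isAlgebra.Build S free_alg free_alg_scaleAr.

Definition free_gen (i : 'I_m) : free_alg := << fmu i >>.

End FreeAlgebra.

Section FreeEval.
Variables (S T : comNzRingType) (m : nat) (h : {rmorphism S -> T}).
Variables (B : algType T) (y : 'I_m -> B).

Definition word_eval (w : {fmonom 'I_m}) : B := \prod_(i <- w) y i.

Fact word_eval_morph : mmorphism word_eval.
Proof.
by split=> [u v|]; rewrite /word_eval ?fmM ?big_cat // fm1 big_nil.
Qed.
HB.instance Definition _ := monalg.isMultiplicative.Build {fmonom 'I_m} B
  word_eval word_eval_morph.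

Definition free_eval : free_alg S m -> B :=
  monalg.mmap (in_alg B \o h) word_eval.

Fact free_eval_zmod_morphism : zmod_morphism free_eval.
Proof. exact: raddfB. Qed.
Fact free_eval_monoid_morphism : monoid_morphism free_eval.
Proof.
have [|eM e1] :=
  @monalg.commr_mmap_is_multiplicative _ _ _ (in_alg B \o h) word_eval.
- by move=> g u v; rewrite /GRing.comm /= mulr_algl mulr_algr.
- by split.
Qed.
HB.instance Definition _ := GRing.isZmodMorphism.Build (free_alg S m) B free_eval
  free_eval_zmod_morphism.
HB.instance Definition _ := GRing.isMonoidMorphism.Build (free_alg S m) B
  free_eval free_eval_monoid_morphism.

Lemma free_eval_gen i : free_eval (free_gen S i) = y i.
Proof.
rewrite /free_eval /free_gen monalg.mmapU /= rmorph1 scale1r mul1r /word_eval fmU.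
by rewrite big_seq1.
Qed.

Lemma free_evalZ c a : free_eval (c *: a) = h c *: free_eval a.
Proof. by rewrite /free_eval monalg.mmapZ /= mulr_algl. Qed.

End FreeEval.

Inductive generated_ideal2 (R : nzRingType) (X : R -> Prop) : R -> Prop :=
| GenIdeal_mem a of X a : generated_ideal2 X a
| GenIdeal_0 : generated_ideal2 X 0
| GenIdeal_B a b of generated_ideal2 X a & generated_ideal2 X b :
    generated_ideal2 X (a - b)
| GenIdeal_Ml r a of generated_ideal2 X a : generated_ideal2 X (r * a)
| GenIdeal_Mr r a of generated_ideal2 X a : generated_ideal2 X (a * r).

Lemma generated_ideal2_ker (R R' : nzRingType) (f : {rmorphism R -> R'})
    (X : R -> Prop) :
  (forall a, X a -> f a = 0) -> forall a, generated_ideal2 X a -> f a = 0.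
Proof.
move=> fX a; elim=> {a} [a /fX //||a b _ fa _ fb|r a _ fa|r a _ fa].
- by rewrite rmorph0.
- by rewrite rmorphB /= fa fb subrr.
- by rewrite rmorphM /= fa mulr0.
- by rewrite rmorphM /= fa mul0r.
Qed.

Section WeylIndices.
Variable n : nat.

Fact odd_index_subproof (l : 'I_n) : (l.*2 < n.*2)%N.
Proof. by rewrite ltn_double. Qed.
Fact even_index_subproof (l : 'I_n) : (l.*2.+1 < n.*2)%N.
Proof. by rewrite -doubleS leq_double. Qed.

(* The positions of [x_{2l-1}] and [x_{2l}], for [l : 'I_n] standing for the
   1-based index [l.+1]. *)
Definition odd_index (l : 'I_n) : 'I_n.*2 := Ordinal (odd_index_subproof l).
Definition even_index (l : 'I_n) : 'I_n.*2 := Ordinal (even_index_subproof l).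

Definition conjugate_pair (i j : 'I_n.*2) : bool :=
  [exists l, (j == even_index l) && (i == odd_index l)].

Lemma conjugate_pairE i j :
  conjugate_pair i j = (j == i.+1 :> nat) && ~~ odd i.
Proof.
apply/existsP/andP => [[l /andP[/eqP-> /eqP->]]|[/eqP ji ei]] /=.
  by rewrite odd_double.
have i2 : i./2.*2 = i by rewrite -[RHS]odd_double_half (negPf ei).
have lt_n : (i./2 < n)%N by rewrite -ltn_double i2.
by exists (Ordinal lt_n); rewrite -!val_eqE /= ji i2 !eqxx.
Qed.

End WeylIndices.

Section TowerRelations.
Variables (S : comNzRingType) (q : S).

Lemma weyl_tower_rel n i j : (i < j < n.*2)%N ->
  weyl_tower_gen q n j * weyl_tower_gen q n i
  - weyl_tower_gen q n i * weyl_tower_gen q n j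
  = if (j == i.+1) && ~~ odd i then q%:A else 0.
Proof.
elim: n i j => [|n IHn] i j /andP[lt_ij]; first by rewrite ltn0.
rewrite doubleS ltnS leq_eqVlt => /orP[/eqP ej|].
  have ni : (i == n.*2.+1) = false by apply/negbTE; rewrite neq_ltn -ej lt_ij.
  rewrite /= ej eqxx ni skew_var_const addrC addKr eqSS [n.*2 == i]eq_sym.
  case: eqP => [->|_] /=; last by rewrite partial_derivation_const rmorph0.
  by rewrite odd_double /tower_derivation partial_derivation_var rmorph_alg.
rewrite ltnS leq_eqVlt => /orP[/eqP ej|lt_jn].
  have ni : (i == n.*2) = false by apply/negbTE; rewrite neq_ltn -ej lt_ij.
  have ni1 : (i == n.*2.+1) = false.
    by apply/negbTE; rewrite neq_ltn -ej ltnS ltnW.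
  rewrite /= ej ni ni1 ltn_eqF // eqxx -!rmorphM -rmorphB /=.
  rewrite skew_var_const /= addrC addKr [skew_const (zero_derivation _) _]raddf0.
  rewrite raddf0.
  by case: eqP => // e; move: (congr1 odd e); rewrite /= odd_double; case: odd.
have lt_in := ltn_trans lt_ij lt_jn.
have [ltS_in ltS_jn] := (ltnW lt_in, ltnW lt_jn).
rewrite /= (ltn_eqF lt_in) (ltn_eqF lt_jn) (ltn_eqF (ltS_in : i < n.*2.+1)%N).
rewrite (ltn_eqF (ltS_jn : j < n.*2.+1)%N).
rewrite -!rmorphM -rmorphB -rmorphB IHn ?lt_ij //.
by case: ifP => _; rewrite ?raddf0 //= !rmorph_alg.
Qed.

End TowerRelations.

Section WeylPresentation.
Variables (S : comNzRingType) (c : S) (n : nat).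
Local Notation F := (free_alg S n.*2).
Local Notation X := (@free_gen S n.*2).

Definition weyl_relator (r : F) : Prop :=
  exists i j : 'I_n.*2, (i < j)%N /\
    r = X j * X i - X i * X j - (if conjugate_pair i j then c%:A else 0).

Lemma weyl_relator_eval (T : comNzRingType) (h : {rmorphism S -> T}) r :
  generated_ideal2 weyl_relator r ->
  free_eval h (fun i : 'I_n.*2 => weyl_tower_gen (h c) n i) r = 0.
Proof.
move: r; apply: generated_ideal2_ker => _ [i [j [lt_ij ->]]].
rewrite !rmorphB !rmorphM /= !free_eval_gen weyl_tower_rel ?lt_ij ?ltn_ord //.
rewrite conjugate_pairE; case: ifP => _; last by rewrite rmorph0 subrr.
by rewrite free_evalZ rmorph1 subrr.
Qed.

Fact weyl_ideal_proper : ~ generated_ideal2 weyl_relator 1.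
Proof.
by move/(weyl_relator_eval idfun)/eqP; rewrite rmorph1 oner_eq0.
Qed.

Definition weyl_ideal : proper_ideal2 F :=
  ProperIdeal2 (GenIdeal_0 _) (@GenIdeal_B _ _) (@GenIdeal_Ml _ _)
    (@GenIdeal_Mr _ _) weyl_ideal_proper.

(* The [S]-algebra generated by [x_1, ..., x_{2n}] subject to the relations
   [x_j x_i - x_i x_j = c] if [j = 2l] and [i = 2l-1] for some [l], and
   [x_j x_i - x_i x_j = 0] for all other [j > i]. *)
Definition weyl_pres : algType S := quot_alg weyl_ideal.

Definition weyl_pres_gen (i : 'I_n.*2) : weyl_pres := quot_proj weyl_ideal (X i).

End WeylPresentation.

Definition weyl (k : comNzRingType) (n : nat) : algType k := weyl_pres (1 : k) n.
Definition weyl_gen (k : comNzRingType) (n : nat) : 'I_n.*2 -> weyl k n :=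
  @weyl_pres_gen k 1 n.

(* [A_n]; the indeterminate [t] is ['X : {poly k}]. *)
Definition genericA (k : comNzRingType) (n : nat) : algType {poly k} :=
  weyl_pres ('X : {poly k}) n.
Definition genericA_gen (k : comNzRingType) (n : nat) :
  'I_n.*2 -> genericA k n := @weyl_pres_gen {poly k} 'X n.

Section Specialization.
Variables (k : comNzRingType) (n : nat) (q : k).

Definition genericA_k : algType k :=
  restrict_scalars (@polyC k : {rmorphism k -> {poly k}}) (genericA k n).

Definition tq_mem (a : genericA_k) : Prop :=
  exists b : genericA k n, a = ('X - q%:P) *: b.

Fact tq_0 : tq_mem 0. Proof. by exists 0; rewrite scaler0. Qed.
Fact tq_B a b : tq_mem a -> tq_mem b -> tq_mem (a - b).
Proof. by move=> [a' ->] [b' ->]; exists (a' - b'); rewrite scalerBr. Qed.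
Fact tq_Ml r a : tq_mem a -> tq_mem (r * a).
Proof.
move=> [a' ->]; exists ((r : genericA k n) * a').
exact/esym/(scalerAr _ (r : genericA k n)).
Qed.
Fact tq_Mr r a : tq_mem a -> tq_mem (a * r).
Proof.
move=> [a' ->]; exists (a' * (r : genericA k n)).
exact/esym/(scalerAl _ a').
Qed.
Fact tq_proper : ~ tq_mem 1.
Proof.
move=> [b]; have [b' ->] := quot_proj_surj b => e1.
have /(weyl_relator_eval (horner_eval q)) :
    generated_ideal2 (weyl_relator ('X : {poly k}) (n := n))
      (1 - ('X - q%:P) *: b').
  by apply/(@quot_projP _ (weyl_ideal _ _)); rewrite rmorph1 e1 linearZ.
move/eqP; rewrite rmorphB rmorph1 /= free_evalZ /= /horner_eval.
by rewrite !hornerE subrr scale0r subr0 oner_eq0.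
Qed.

Definition tq_ideal : proper_ideal2 genericA_k :=
  ProperIdeal2 tq_0 tq_B tq_Ml tq_Mr tq_proper.

(* [A_q = A_n / (t - q) A_n] *)
Definition specA : algType k := quot_alg tq_ideal.
Definition specA_gen (i : 'I_n.*2) : specA :=
  quot_proj tq_ideal (genericA_gen k i).

End Specialization.

Definition standard_word (m : nat) : Type :=
  {w : seq 'I_m | sorted (fun i j : 'I_m => i <= j)%N w}.
HB.instance Definition _ m := Choice.on (standard_word m).

Definition standard_monomial (R : nzRingType) (m : nat) (x : 'I_m -> R)
  (w : standard_word m) : R := \prod_(i <- val w) x i.

Definition is_basis (S : nzRingType) (V : lmodType S) (I : eqType) (b : I -> V)
    : Prop :=
  (forall (s : seq I) (a : I -> S), uniq s ->
     \sum_(i <- s) a i *: b i = 0 -> forall i, i \in s -> a i = 0) /\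
  (forall v : V, exists (s : seq I) (a : I -> S), v = \sum_(i <- s) a i *: b i).

HB.mixin Record hasPoissonBracket (S : comNzRingType) V
    of GRing.ComAlgebra S V := {
  poisson_bracket : V -> V -> V;
  poisson_bracketPl : forall (c : S) (f g h : V),
    poisson_bracket (c *: f + g) h
    = c *: poisson_bracket f h + poisson_bracket g h;
  poisson_bracket_alt : forall f : V, poisson_bracket f f = 0;
  poisson_bracket_leibniz : forall f g h : V,
    poisson_bracket (f * g) h
    = f * poisson_bracket g h + poisson_bracket f h * g;
  poisson_bracket_jacobi : forall f g h : V,
    poisson_bracket f (poisson_bracket g h)
    + poisson_bracket g (poisson_bracket h f)
    + poisson_bracket h (poisson_bracket f g) = 0
}.

#[short(type="poissonAlgType")]
HB.structure Definition PoissonAlgebra (S : comNzRingType) :=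
  {V of GRing.ComAlgebra S V & hasPoissonBracket S V}.

Section PoissonWeyl.
Variables (k : comNzRingType) (n : nat).

Definition poisson_weyl : Type := mpoly n.*2 k.
HB.instance Definition _ := GRing.ComAlgebra.on poisson_weyl.

Local Notation B := (mpoly n.*2 k).
Implicit Types f g h p : B.

Definition weyl_bracket (f g : B) : B :=
  \sum_(l < n) (- (f^`M(odd_index l) * g^`M(even_index l))
                + g^`M(odd_index l) * f^`M(even_index l)).

Lemma weyl_bracketPl c f g h :
  weyl_bracket (c *: f + g) h = c *: weyl_bracket f h + weyl_bracket g h.
Proof.
rewrite /weyl_bracket scaler_sumr -big_split /=; apply: eq_bigr => l _.
rewrite !mderivD !mderivZ !mulrDl !mulrDr -!scalerAl -!scalerAr scalerDr scalerN.
by rewrite opprD addrACA.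
Qed.

Lemma weyl_bracketC f g : weyl_bracket f g = - weyl_bracket g f.
Proof.
rewrite /weyl_bracket -sumrN; apply: eq_bigr => l _.
by rewrite opprD opprK addrC.
Qed.

Lemma weyl_bracket_alt f : weyl_bracket f f = 0.
Proof. by rewrite /weyl_bracket big1 // => l _; rewrite addNr. Qed.

Lemma weyl_bracket_leibniz f g h :
  weyl_bracket (f * g) h = f * weyl_bracket g h + weyl_bracket f h * g.
Proof.
rewrite /weyl_bracket mulr_sumr mulr_suml -big_split /=; apply: eq_bigr => l _.
rewrite !mderivM; ring.
Qed.

Lemma weyl_bracketDl f g h :
  weyl_bracket (f + g) h = weyl_bracket f h + weyl_bracket g h.
Proof. by rewrite -[f in LHS]scale1r weyl_bracketPl scale1r. Qed.

Lemma weyl_bracketDr f g h :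
  weyl_bracket h (f + g) = weyl_bracket h f + weyl_bracket h g.
Proof.
by rewrite weyl_bracketC weyl_bracketDl opprD -!(weyl_bracketC h).
Qed.

Lemma weyl_bracket0l h : weyl_bracket 0 h = 0.
Proof.
rewrite /weyl_bracket big1 // => l _.
by rewrite !mderiv0 mul0r mulr0 oppr0 addr0.
Qed.

Lemma weyl_bracketZl c f h : weyl_bracket (c *: f) h = c *: weyl_bracket f h.
Proof. by rewrite -[c *: f]addr0 weyl_bracketPl weyl_bracket0l addr0. Qed.

Lemma weyl_bracketZr c f h : weyl_bracket h (c *: f) = c *: weyl_bracket h f.
Proof. by rewrite weyl_bracketC weyl_bracketZl -scalerN -weyl_bracketC. Qed.

Lemma weyl_bracket_leibnizr f g h :
  weyl_bracket h (f * g) = f * weyl_bracket h g + weyl_bracket h f * g.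
Proof.
rewrite weyl_bracketC weyl_bracket_leibniz opprD -mulrN -mulNr.
by rewrite -!(weyl_bracketC h).
Qed.

Lemma mderiv_weyl_bracket i f g :
  (weyl_bracket f g)^`M(i) = weyl_bracket f^`M(i) g + weyl_bracket f g^`M(i).
Proof.
rewrite /weyl_bracket raddf_sum /= -big_split /=; apply: eq_bigr => l _.
rewrite mderivD mderivN !mderivM ![_^`M(i)^`M(_)]mderiv_comm; ring.
Qed.

Lemma mpoly_derivation_eq0 (D : B -> B) :
    (forall c f g, D (c *: f + g) = c *: D f + D g) ->
    (forall f g, D (f * g) = f * D g + D f * g) ->
    (forall i, D 'X_i = 0) -> forall f, D f = 0.
Proof.
move=> DP DM DX.
have D0 : D 0 = 0.
  have := DP 1 0 0; rewrite !scale1r addr0 => /eqP.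
  by rewrite -subr_eq0 opprD addNKr oppr_eq0 => /eqP.
have D1 : D 1 = 0.
  have := DM 1 1; rewrite !(mulr1, mul1r) => /eqP.
  by rewrite -subr_eq0 opprD addNKr oppr_eq0 => /eqP.
have DXn i e : D ('X_i ^+ e) = 0.
  by elim: e => [|e IHe]; rewrite ?expr0 // exprS DM IHe DX mulr0 mul0r addr0.
move=> f; elim/mpolyind: f => // c m p _ _ IHp.
rewrite DP IHp addr0 mpolyXE_id.
suff ->: D (\prod_(i < n.*2) 'X_i ^+ m i) = 0 by rewrite scaler0.
apply: (big_ind (fun u => D u = 0)) => // u v Du Dv.
by rewrite DM Du Dv mulr0 mul0r addr0.
Qed.

Lemma weyl_indexP (i : 'I_n.*2) :
  (exists l, i = odd_index l) \/ (exists l, i = even_index l).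
Proof.
have ei := odd_double_half i.
have lt_n : (i./2 < n)%N.
  by rewrite -ltn_double (leq_ltn_trans _ (ltn_ord i)) // -{2}ei leq_addl.
case oi: (odd i) ei => ei; [right|left]; exists (Ordinal lt_n).
  by apply/val_inj; rewrite /= -[LHS]ei.
by apply/val_inj; rewrite /= -[LHS]ei.
Qed.

Lemma weyl_bracketX_even f l :
  weyl_bracket f 'X_(even_index l) = - f^`M(odd_index l).
Proof.
rewrite /weyl_bracket (bigD1 l) //= big1 ?addr0 => [|m ne_ml].
  rewrite !mderivX !mnm1E eqxx -!val_eqE /= gtn_eqF //.
  rewrite scale0r mul0r addr0 scale1r; congr (- _).
  have -> : (U_(even_index l) - U_(even_index l) = 0)%MM.
    by apply/mnmP => m; rewrite mnmBE subnn mnm0E.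
  by rewrite mpolyX0 mulr1.
rewrite !mderivX !mnm1E -!val_eqE /= eqSS.
have -> : (l.*2.+1 == m.*2) = false.
  by apply/eqP => /(congr1 odd); rewrite /= !odd_double.
have -> : (l.*2 == m.*2) = false.
  rewrite -(inj_eq val_inj) in ne_ml.
  by apply/negbTE; rewrite -!muln2 eqn_pmul2r // eq_sym.
by rewrite !scale0r mulr0 mul0r oppr0 addr0.
Qed.

Lemma weyl_bracketX_odd f l :
  weyl_bracket f 'X_(odd_index l) = f^`M(even_index l).
Proof.
rewrite /weyl_bracket (bigD1 l) //= big1 ?addr0 => [|m ne_ml].
  rewrite !mderivX !mnm1E eqxx -!val_eqE /= ltn_eqF //.
  rewrite scale0r mulr0 oppr0 add0r scale1r.
  have -> : (U_(odd_index l) - U_(odd_index l) = 0)%MM.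
    by apply/mnmP => m; rewrite mnmBE subnn mnm0E.
  by rewrite mpolyX0 mul1r.
rewrite !mderivX !mnm1E -!val_eqE /=.
have -> : (l.*2 == m.*2.+1) = false.
  by apply/eqP => /(congr1 odd); rewrite /= !odd_double.
have -> : (l.*2 == m.*2) = false.
  rewrite -(inj_eq val_inj) in ne_ml.
  by apply/negbTE; rewrite -!muln2 eqn_pmul2r // eq_sym.
by rewrite !scale0r mulr0 mul0r oppr0 addr0.
Qed.

Lemma weyl_bracketNr f h : weyl_bracket h (- f) = - weyl_bracket h f.
Proof. by rewrite -scaleN1r weyl_bracketZr scaleN1r. Qed.

Lemma weyl_bracket_jacobi f g h :
  weyl_bracket f (weyl_bracket g h) + weyl_bracket g (weyl_bracket h f)
  + weyl_bracket h (weyl_bracket f g) = 0.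
Proof.
move: h; apply: mpoly_derivation_eq0 => [c h p|h p|i].
- rewrite !(weyl_bracketPl, weyl_bracketDr, weyl_bracketZr) !scalerDr.
  rewrite -!mul_mpolyC; ring.
- rewrite !(weyl_bracket_leibnizr, weyl_bracket_leibniz, weyl_bracketDr).
  rewrite (weyl_bracketC h f) (weyl_bracketC p f).
  rewrite (weyl_bracketC h (weyl_bracket f g)).
  rewrite (weyl_bracketC p (weyl_bracket f g)).
  rewrite (weyl_bracketC (weyl_bracket f g)).
  ring.
- rewrite (weyl_bracketC 'X_i f) (weyl_bracketC 'X_i (weyl_bracket f g)).
  rewrite weyl_bracketNr; case: (weyl_indexP i) => -[l ->].
    rewrite !weyl_bracketX_odd mderiv_weyl_bracket.
    rewrite (weyl_bracketC g); ring.
  rewrite !weyl_bracketX_even mderiv_weyl_bracket !weyl_bracketNr.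
  rewrite (weyl_bracketC g); ring.
Qed.

HB.instance Definition _ :=
  @hasPoissonBracket.Build k poisson_weyl weyl_bracket
    weyl_bracketPl weyl_bracket_alt weyl_bracket_leibniz weyl_bracket_jacobi.

Definition poisson_weyl_gen (i : 'I_n.*2) : poisson_weyl := 'X_i.

End PoissonWeyl.

(* Main.v *)
Require Import Defs.
From HB Require Import structures.
From mathcomp.multinomials Require Import monalg mpoly.
From mathcomp Require Import all_boot all_order all_algebra.

Set Implicit Arguments.
Unset Strict Implicit.
Unset Printing Implicit Defensive.

Import GRing.Theory.
Local Open Scope ring_scope.

(** The presented algebra with relations [x_j x_i - x_i x_j = c] maps onto the
    iterated skew polynomial algebra by its universal property, and the tower
    maps back by the universal property of each of its stages: a morphism out of
    [R[z; nu]] is a morphism [f] out of [R] together with an element [z] such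
    that [z f(a) = f(a) z + f(nu a)], a condition that only needs to be checked
    on generators [a] of [R].  Both composites fix generators, so the two
    algebras are isomorphic and no straightening argument is needed.  The same
    comparison of generators identifies [A_q] with the presented algebra over
    [k] ([t] acts as [q]) and rescales [q] to [1].  In the tower the standard
    monomials form a basis because [R[z; nu]] is free over [R] on the powers of
    [z]; independence is carried through the stages by dual functionals. *)

(** * Generation of an algebra by a family of elements *)

(** Generation is encoded as an induction principle, so that [elim] can use it directly. Closure
    under subtraction is implied, since [-1] is a scalar. *)
Definition generated_by (S : comNzRingType) (A : algType S) (I : Type)
    (y : I -> A) : Prop :=
  forall P : A -> Prop, (forall c : S, P c%:A) ->
    (forall a b, P a -> P b -> P (a + b)) ->
    (forall a b, P a -> P b -> P (a * b)) ->
    (forall i, P (y i)) -> forall a, P a.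

Lemma generated_by_eq (S : comNzRingType) (A B : algType S) (I : Type)
    (y : I -> A) (f g : {lrmorphism A -> B}) :
  generated_by y -> (forall i, f (y i) = g (y i)) -> f =1 g.
Proof.
move=> gen_y fg a; elim/gen_y: a => [c|a b ea eb|a b ea eb|//].
- by rewrite !rmorph_alg.
- by rewrite !rmorphD /= ea eb.
- by rewrite !rmorphM /= ea eb.
Qed.

Lemma generated_by_iso (S : comNzRingType) (A B : algType S) (I : Type)
    (y : I -> A) (z : I -> B) (f : {lrmorphism A -> B})
    (g : {lrmorphism B -> A}) :
  generated_by y -> generated_by z ->
  (forall i, f (y i) = z i) -> (forall i, g (z i) = y i) ->
  cancel f g /\ cancel g f.
Proof.
move=> gen_y gen_z fy gz; split.
  apply: (generated_by_eq (f := g \o f) (g := idfun) gen_y) => i /=.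
  by rewrite fy gz.
apply: (generated_by_eq (f := f \o g) (g := idfun) gen_z) => i /=.
by rewrite gz fy.
Qed.

(** * Morphisms out of quotients and free algebras *)

Section QuotientLift.
Variables (R R' : nzRingType) (I : proper_ideal2 R) (f : {rmorphism R -> R'}).
Hypothesis fI : forall a, I a -> f a = 0.

(** The [let] makes [fI] an argument of the map, so that the morphism structures, whose proofs rely
    on [fI], can be attached to it. *)
Definition quot_lift (x : quot_alg I) : R' := let _ := fI in f (repr x).

Lemma quot_liftE a : quot_lift (quot_proj I a) = f a.
Proof.
apply/eqP; rewrite -subr_eq0 -rmorphB; apply/eqP/fI.
exact: repr_quot_proj.
Qed.

Fact quot_lift_zmod_morphism : zmod_morphism quot_lift.
Proof.
move=> x y; have [a ->] := quot_proj_surj x; have [b ->] := quot_proj_surj y.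
by rewrite -rmorphB !quot_liftE rmorphB.
Qed.
Fact quot_lift_monoid_morphism : monoid_morphism quot_lift.
Proof.
split=> [|x y]; first by rewrite -(rmorph1 (quot_proj I)) quot_liftE rmorph1.
have [a ->] := quot_proj_surj x; have [b ->] := quot_proj_surj y.
by rewrite -rmorphM !quot_liftE rmorphM.
Qed.
HB.instance Definition _ := GRing.isZmodMorphism.Build (quot_alg I) R' quot_lift
  quot_lift_zmod_morphism.
HB.instance Definition _ := GRing.isMonoidMorphism.Build (quot_alg I) R'
  quot_lift quot_lift_monoid_morphism.

End QuotientLift.

(** Linearity is often known only from a local hypothesis; this packs it with the ring morphism into
    an algebra morphism. *)
Lemma rmorphism_to_lrmorphism (S : comNzRingType) (A B : algType S)
    (f : {rmorphism A -> B}) :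
  scalable f -> exists g : {lrmorphism A -> B}, g =1 f.
Proof.
move=> fZ.
pose s := GRing.isScalable.Build S A B *:%R f fZ.
pose g : {lrmorphism A -> B} := HB.pack (f : A -> B) f s.
by exists g.
Qed.

Lemma quot_lift_alg (S : comNzRingType) (R B : algType S) (I : proper_ideal2 R)
    (f : {rmorphism R -> B}) :
  scalable f -> (forall a, I a -> f a = 0) ->
  exists g : {lrmorphism quot_alg I -> B}, forall a, g (quot_proj I a) = f a.
Proof.
move=> fZ fI.
have [|g gE] := @rmorphism_to_lrmorphism S (quot_alg I) B (quot_lift fI).
  move=> c x; have [a ->] := quot_proj_surj x.
  by rewrite -linearZ /= !quot_liftE fZ.
by exists g => a; rewrite gE /= quot_liftE.
Qed.

Lemma free_generated (S : comNzRingType) (m : nat) :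
  generated_by (@free_gen S m).
Proof.
move=> P PC PD PM Pgen a.
have Pword (w : {fmonom 'I_m}) : P (<< w >> : {malg S[{fmonom 'I_m}]}).
  (* A word is the product of its letters, so closure under products reaches every basis element of
     the monoid algebra. *)
  have [s ->] : exists s : seq 'I_m, w = \big[mmul/mone]_(i <- s) fmu i.
    exists w; apply/val_inj; rewrite /=.
    elim: (fmonom_val w) => [|i s IHs] /=.
      by rewrite big_nil fm1.
    by rewrite big_cons [RHS]fmM fmU -IHs.
  elim: s => [|i s IHs]; first by rewrite big_nil -[<< _ >>]scale1r; apply: PC.
  rewrite big_cons; set u := bigop _ _ _ in IHs *.
  have := PM _ _ (Pgen i) IHs; congr P.
  by rewrite /free_gen [LHS]fgmulUU mulr1.
rewrite (monalgE a); apply: (big_ind P) => [|//|w _].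
  by have := PC 0; rewrite scale0r.
rewrite (_ : << _ *g w >> = (monalg.mcoeff w a)%:A * << w >> :> free_alg S m).
  exact: PM (PC _) (Pword w).
rewrite mulr_algl; apply/malgP => v.
by rewrite monalg.mcoeffZ !monalg.mcoeffU mulr_natr.
Qed.

(** * Universal property of a skew polynomial algebra *)

Section SkewUniversal.
Variables (S : comNzRingType) (R B : algType S) (nu : derivation R).
Variables (f : {lrmorphism R -> B}) (z : B).
Hypothesis zf : forall a, z * f a = f a * z + f (nu a).

(** Coefficients stand to the left of the powers of the variable, both in [skew_poly] and in
    polynomial evaluation, so the map is plain evaluation at [z]; the commutation [zf] makes it
    multiplicative for the skew product. *)
Definition skew_eval (p : skew_poly nu) : B :=
  let _ := zf in (map_poly f (p : {poly R})).[z].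

Lemma skew_evalC a : skew_eval (skew_const nu a) = f a.
Proof. by rewrite /skew_eval map_polyC hornerC. Qed.

Lemma skew_evalX : skew_eval (skew_var nu) = z.
Proof. by rewrite /skew_eval map_polyX hornerX. Qed.

Fact skew_eval_zmod_morphism : zmod_morphism skew_eval.
Proof. by move=> p q; rewrite /skew_eval raddfB /= hornerD hornerN. Qed.
HB.instance Definition _ := GRing.isZmodMorphism.Build (skew_poly nu) B
  skew_eval skew_eval_zmod_morphism.

Lemma skew_evalD (p q : {poly R}) :
  skew_eval (p + q) = skew_eval p + skew_eval q.
Proof. by rewrite /skew_eval raddfD hornerD. Qed.

Lemma skew_evalMX (p : {poly R}) : skew_eval (p * 'X) = skew_eval p * z.
Proof. by rewrite /skew_eval rmorphM /= map_polyX hornerMX. Qed.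

Lemma skew_evalZ a (p : {poly R}) : skew_eval (a *: p) = f a * skew_eval p.
Proof. by rewrite /skew_eval map_polyZ hornerZ. Qed.

(** Multiplicativity when the left factor is the variable; the general case reduces to it through
    [skew_mulMX]. The relation [zf] enters at the constant coefficient. *)
Lemma skew_eval_varmul (p : {poly R}) :
  skew_eval (skew_varmul nu p) = z * skew_eval p.
Proof.
elim/poly_ind: p => [|p a IHp].
  by rewrite !raddf0 /= mulr0.
have -> : skew_varmul nu (p * 'X + a%:P) =
    skew_varmul nu (p * 'X) + skew_varmul nu a%:P by rewrite raddfD.
rewrite skew_varmulX skew_varmulC !skew_evalD !skew_evalMX IHp mulrDr mulrA.
by rewrite skew_evalZ [skew_eval 'X]skew_evalX !skew_evalC zf.
Qed.

Fact skew_eval_monoid_morphism : monoid_morphism skew_eval.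
Proof.
split=> [|p q].
  by rewrite -[1 in LHS]/(skew_const nu 1) skew_evalC rmorph1.
change (skew_eval (skew_mul nu p q) = skew_eval p * skew_eval q).
elim/poly_ind: p q => [|p a IHp] q.
  by rewrite -[0]/(0%:P) skew_mulC scale0r raddf0 mul0r.
rewrite skew_mulDl skew_mulMX skew_mulC !skew_evalD.
by rewrite IHp skew_eval_varmul skew_evalMX skew_evalZ skew_evalC mulrDl mulrA.
Qed.
HB.instance Definition _ := GRing.isMonoidMorphism.Build (skew_poly nu) B
  skew_eval skew_eval_monoid_morphism.

Fact skew_eval_scalable : scalable skew_eval.
Proof.
move=> c p; rewrite -[c *: p]/(c%:A *: (p : {poly R})) skew_evalZ.
by rewrite rmorph_alg mulr_algl.
Qed.
HB.instance Definition _ := GRing.isScalable.Build S (skew_poly nu) B *:%R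
  skew_eval skew_eval_scalable.

Lemma skew_universal : exists F : {lrmorphism skew_poly nu -> B},
  (forall a, F (skew_const nu a) = f a) /\ F (skew_var nu) = z.
Proof.
by exists skew_eval; split=> [a|] /=; [apply: skew_evalC|apply: skew_evalX].
Qed.

End SkewUniversal.

(** A skew polynomial is a finite sum of constants times powers of the variable, and the constants
    are generated by the images of the [y i]. *)
Lemma skew_generated (S : comNzRingType) (R : algType S) (nu : derivation R)
    (I J : Type) (y : I -> R) (z : J -> skew_poly nu) :
  generated_by y ->
  (forall i, exists j, z j = skew_const nu (y i)) ->
  (exists j, z j = skew_var nu) -> generated_by z.
Proof.
move=> gen_y zy [jv zv] P PC PD PM Pz p.
have Pvar : P (skew_var nu) by rewrite -zv.
have Pconst a : P (skew_const nu a).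
  elim/gen_y: a => [c|a b Pa Pb|a b Pa Pb|i].
  - by rewrite rmorph_alg; apply: PC.
  - by rewrite rmorphD; apply: PD.
  - by rewrite rmorphM; apply: PM.
  - by have [j <-] := zy i.
have P1 : P 1 by have := PC 1; rewrite scale1r.
rewrite (skew_poly_expand p); apply: (big_ind P) => [|//|i _].
  by have := PC 0; rewrite scale0r.
apply: (PM) (Pconst _) _; elim: (i : nat) => // e IHe.
by rewrite exprS; apply: PM.
Qed.

(** The elements satisfying the commutation form a subalgebra: scalars are central and killed by
    [nu], and the Leibniz rule gives closure under products. *)
Lemma derivation_commutation (S : comNzRingType) (R B : algType S)
    (nu : derivation R) (f : {lrmorphism R -> B}) (z : B)
    (I : Type) (y : I -> R) :
  generated_by y ->
  (forall i, z * f (y i) = f (y i) * z + f (nu (y i))) ->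
  forall a, z * f a = f a * z + f (nu a).
Proof.
move=> gen_y zy; elim/gen_y => [c|a b ea eb|a b ea eb|//].
- by rewrite derivation_alg raddf0 addr0 rmorph_alg mulr_algl mulr_algr.
- by rewrite !(raddfD, mulrDl, mulrDr) ea eb addrACA.
- rewrite derivation_leibniz raddfD /= !rmorphM mulrA ea mulrDl -mulrA eb.
  by rewrite mulrDr mulrA addrAC addrA.
Qed.

Lemma derivation_eq (S : comNzRingType) (R : algType S) (nu mu : derivation R)
    (I : Type) (y : I -> R) :
  generated_by y -> (forall i, nu (y i) = mu (y i)) -> nu =1 mu.
Proof.
move=> gen_y eq_y; elim/gen_y => [c|a b ea eb|a b ea eb|//].
- by rewrite !derivation_alg.
- by rewrite !raddfD /= ea eb.
- by rewrite !derivation_leibniz ea eb.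
Qed.

(** * Generators and universal property of the tower *)

Section TowerGenerators.
Variables (S : comNzRingType) (q : S).

Lemma odd_tower_generated_step n :
  generated_by (fun i : 'I_n.*2 => weyl_tower_gen q n i) ->
  generated_by (fun i : 'I_n.*2.+1 => odd_tower_gen q n i).
Proof.
move=> gen; apply: (skew_generated gen) => [i|].
  by exists (widen_ord (leqnSn _) i); rewrite /odd_tower_gen /= ltn_eqF.
by exists ord_max; rewrite /odd_tower_gen /= eqxx.
Qed.

Lemma weyl_tower_genS n i : weyl_tower_gen q n.+1 i =
  if i == n.*2.+1 then skew_var (tower_derivation q n)
  else skew_const (tower_derivation q n) (odd_tower_gen q n i).
Proof. by []. Qed.

Lemma weyl_tower_generated n :
  generated_by (fun i : 'I_n.*2 => weyl_tower_gen q n i).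
Proof.
elim: n => [|n /odd_tower_generated_step gen].
  move=> P PC _ _ _ a; have := PC a; congr P.
  exact: mulr1.
apply: (skew_generated gen) => [i|].
  exists (widen_ord (leqnSn _) i); rewrite weyl_tower_genS.
  by rewrite ltn_eqF //= ltn_ord.
by exists ord_max; rewrite weyl_tower_genS /= eqxx.
Qed.

Lemma odd_tower_generated n :
  generated_by (fun i : 'I_n.*2.+1 => odd_tower_gen q n i).
Proof. by apply: odd_tower_generated_step; apply: weyl_tower_generated. Qed.

Lemma tower_derivation_gen l i :
  tower_derivation q l (odd_tower_gen q l i) = if i == l.*2 then q%:A else 0.
Proof.
rewrite /odd_tower_gen; case: eqP => _.
  exact: partial_derivation_var.
exact: partial_derivation_const.
Qed.

(** Induction on [n], extending the morphism by one variable twice per step. Indexing [y] by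
    naturals lets the induction hypothesis apply to the same family. *)
Lemma weyl_tower_universal n (B : algType S) (y : nat -> B) :
  (forall i j, (i < j < n.*2)%N ->
     y j * y i - y i * y j = if (j == i.+1) && ~~ odd i then q%:A else 0) ->
  exists f : {lrmorphism weyl_tower q n -> B},
    forall i, (i < n.*2)%N -> f (weyl_tower_gen q n i) = y i.
Proof.
elim: n => [_|n IHn rel_y].
  have in_algZ : scalable (in_alg B : S^o -> B).
    by move=> c a /=; rewrite scalerA.
  have [f _] := @rmorphism_to_lrmorphism S S^o B (in_alg B) in_algZ.
  by exists f.
have [i j /andP[lt_ij lt_j]|f fy] := IHn.
  by apply: rel_y; rewrite lt_ij doubleS ltnW // ltnW.
have [a|g [gc gv]] := @skew_universal S _ B (zero_derivation _) f (y n.*2).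
  apply: (derivation_commutation (@weyl_tower_generated n)) => i.
  rewrite raddf0 addr0 fy //; apply/eqP; rewrite -subr_eq0.
  (* The even index [n.*2] is never the successor of an even index, so its image commutes with all
     earlier ones, as the zero derivation demands. *)
  rewrite rel_y ?ltn_ord ?doubleS //=; case: ifP => // /andP[/eqP e].
  by move: (congr1 odd e) => /=; rewrite odd_double => /esym/negbFE ->.
have gy i : (i <= n.*2)%N -> g (odd_tower_gen q n i) = y i.
  rewrite /odd_tower_gen leq_eqVlt; case: eqP => [->|_] //= lt_i.
  by rewrite gc fy.
have [a|h [hc hv]] :=
    @skew_universal S _ B (tower_derivation q n) g (y n.*2.+1).
  apply: (derivation_commutation (@odd_tower_generated n)) => i.
  have le_i : (i <= n.*2)%N by rewrite -ltnS.
  rewrite tower_derivation_gen // gy //; apply/eqP.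
  rewrite addrC -subr_eq rel_y ?ltn_ord ?doubleS ?ltnSn //.
  (* Among the earlier indices only [n.*2] is conjugate to [n.*2.+1]; there the commutator is [q],
     the value of the derivation on that generator. *)
  rewrite eqSS [n.*2 == _]eq_sym.
  case: (nat_of_ord i =P n.*2) => [->|_] /=; last by rewrite raddf0.
  by rewrite odd_double rmorph_alg.
exists h => i; rewrite doubleS ltnS leq_eqVlt weyl_tower_genS.
by case: eqP => [->|_] //=; rewrite ltnS => lt_i; rewrite hc gy.
Qed.

End TowerGenerators.

(** * The presented algebra compared with the tower and rescaled *)

Lemma commutatorZ (S : comNzRingType) (A : algType S) (c d : S) (x y : A) :
  (c *: x) * (d *: y) - (d *: y) * (c *: x) = (c * d) *: (x * y - y * x).
Proof. by rewrite -!scalerAl -!scalerAr !scalerA [d * c]mulrC -scalerBr. Qed.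

Lemma quot_proj_alg (S : comNzRingType) (R : algType S) (I : proper_ideal2 R)
    (c : S) : quot_proj I c%:A = c%:A.
Proof. by rewrite linearZ rmorph1. Qed.

Lemma rmorph_commutator (R R' : nzRingType) (f : {rmorphism R -> R'})
    (a b : R) :
  f (a * b - b * a) = f a * f b - f b * f a.
Proof. by rewrite rmorphB !rmorphM. Qed.

Definition weyl_relations (S : comNzRingType) (c : S) (n : nat) (B : algType S)
    (y : 'I_n.*2 -> B) : Prop :=
  forall i j : 'I_n.*2, (i < j)%N ->
    y j * y i - y i * y j = if conjugate_pair i j then c%:A else 0.

(** The change of scalars [h] serves two cases: the identity gives the universal property of the
    presentation, and evaluation of [t] at [q] gives the map out of [A_q]. *)
Lemma weyl_relations_ideal (S T : comNzRingType) (h : {rmorphism S -> T})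
    (c : S) (n : nat) (B : algType T) (y : 'I_n.*2 -> B) :
  weyl_relations (h c) y ->
  forall r, weyl_ideal c n r -> free_eval h y r = 0.
Proof.
move=> rel_y; apply: generated_ideal2_ker => _ [i [j [lt_ij ->]]].
rewrite [LHS]rmorphB rmorph_commutator /= !free_eval_gen rel_y //.
apply/eqP; rewrite subr_eq0.
by case: ifP => _; rewrite ?rmorph0 // free_evalZ rmorph1.
Qed.

Section WeylPresentationMorphisms.
Variables (S : comNzRingType) (c : S) (n : nat).

Lemma weyl_pres_relations : weyl_relations c (@weyl_pres_gen S c n).
Proof.
move=> i j lt_ij; pose pr := quot_proj (weyl_ideal c n).
transitivity (pr (if conjugate_pair i j then c%:A else 0)); last first.
  by case: ifP => _; [apply: quot_proj_alg | apply: rmorph0].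
rewrite -[LHS](rmorph_commutator pr); apply/quot_projP/GenIdeal_mem.
by exists i, j.
Qed.

Lemma weyl_pres_generated : generated_by (@weyl_pres_gen S c n).
Proof.
move=> P PC PD PM Pgen x; have [a ->] := quot_proj_surj x.
elim/free_generated: a => [d|a b Pa Pb|a b Pa Pb|//].
- by rewrite quot_proj_alg; apply: PC.
- by rewrite rmorphD; apply: PD.
- by rewrite rmorphM; apply: PM.
Qed.

Lemma weyl_pres_universal (B : algType S) (y : 'I_n.*2 -> B) :
  weyl_relations c y ->
  exists f : {lrmorphism weyl_pres c n -> B},
    forall i, f (weyl_pres_gen c i) = y i.
Proof.
move=> rel_y.
have [|a Ia|f fE] := @quot_lift_alg S _ B (weyl_ideal c n) (free_eval idfun y).
- by move=> d a; rewrite /= free_evalZ.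
- exact: weyl_relations_ideal Ia.
by exists f => i; rewrite fE /= free_eval_gen.
Qed.

Lemma weyl_tower_relations :
  weyl_relations c (fun i : 'I_n.*2 => weyl_tower_gen c n i).
Proof.
by move=> i j lt_ij; rewrite weyl_tower_rel ?lt_ij ?ltn_ord // conjugate_pairE.
Qed.

Lemma weyl_pres_tower_iso :
  exists (f : {lrmorphism weyl_pres c n -> weyl_tower c n})
    (g : {lrmorphism weyl_tower c n -> weyl_pres c n}),
    [/\ cancel f g, cancel g f &
      forall i, f (weyl_pres_gen c i) = weyl_tower_gen c n i].
Proof.
have [f fE] := weyl_pres_universal weyl_tower_relations.
(* The generators are extended by 0 to all naturals, as [weyl_tower_universal] takes a family
   indexed by naturals; only indices below [n.*2] matter. *)
pose y i := if insub i is Some j then weyl_pres_gen c (j : 'I_n.*2) else 0.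
have yE (i : 'I_n.*2) : y i = weyl_pres_gen c i by rewrite /y valK.
have [i j /andP[lt_ij lt_j]|g gE] := @weyl_tower_universal S c n _ y.
  pose i' := Ordinal (ltn_trans lt_ij lt_j); pose j' := Ordinal lt_j.
  have := weyl_pres_relations (lt_ij : i' < j')%N.
  by rewrite conjugate_pairE -!yE.
have gE' (i : 'I_n.*2) : g (weyl_tower_gen c n i) = weyl_pres_gen c i.
  by rewrite gE // yE.
exists f, g; have [fK gK] := generated_by_iso
  weyl_pres_generated (@weyl_tower_generated S c n) fE gE'.
by split.
Qed.

End WeylPresentationMorphisms.

(** Each conjugate pair contains exactly one generator of even index (counting from 0). Multiplying
    these generators by [a] multiplies the conjugate commutators by [a] and keeps the others zero;
    the factors [c / d] and [d / c] give mutually inverse maps. *)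
Lemma weyl_pres_rescale (k : fieldType) (c d : k) (n : nat) :
  c != 0 -> d != 0 ->
  exists f : {lrmorphism weyl_pres c n -> weyl_pres d n}, bijective f.
Proof.
move=> c0 d0.
pose y (e : k) (a : k) (i : 'I_n.*2) : weyl_pres e n :=
  (if odd i then 1 else a) *: weyl_pres_gen e i.
have rel_y (e a : k) : weyl_relations (a * e) (y e a).
  move=> i j lt_ij; rewrite [LHS]commutatorZ weyl_pres_relations //.
  case cij: (conjugate_pair i j); last by rewrite scaler0.
  move: cij; rewrite conjugate_pairE => /andP[/eqP-> /negPf ei].
  by rewrite /= ei /= mul1r scalerA.
have [f fE] : exists f : {lrmorphism weyl_pres c n -> weyl_pres d n},
    forall i, f (weyl_pres_gen c i) = y d (c / d) i.
  by apply: weyl_pres_universal; have := rel_y d (c / d); rewrite divfK.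
have [g gE] : exists g : {lrmorphism weyl_pres d n -> weyl_pres c n},
    forall i, g (weyl_pres_gen d i) = y c (d / c) i.
  by apply: weyl_pres_universal; have := rel_y c (d / c); rewrite divfK.
have cdK : c / d * (d / c) = 1 by rewrite mulrA divfK // divff.
have dcK : d / c * (c / d) = 1 by rewrite mulrC.
have coefK (a b : k) (i : 'I_n.*2) : a * b = 1 ->
    (if odd i then 1 else a) * (if odd i then 1 else b) = 1.
  by case: (odd i); rewrite ?mulr1.
exists f; exists g.
  apply: (generated_by_eq (f := g \o f) (g := idfun)
    (@weyl_pres_generated _ c n)).
  move=> i /=; rewrite fE /y linearZ /= gE /y scalerA.
  rewrite (coefK _ _ i cdK); exact: scale1r.
apply: (generated_by_eq (f := f \o g) (g := idfun)
  (@weyl_pres_generated _ d n)).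
move=> i /=; rewrite gE /y linearZ /= fE /y scalerA.
rewrite (coefK _ _ i dcK); exact: scale1r.
Qed.

(** * The specialization of [t] at [q] *)

Section SpecializationIso.
Variables (k : fieldType) (n : nat) (q : k).

(** By the factor theorem [p - p.[q]] is a multiple of [t - q], so polynomials in [t] act on the
    quotient through their value at [q]. *)
Lemma specA_projZ (p : {poly k}) (a : genericA k n) :
  quot_proj (tq_ideal n q) (p *: a) = p.[q] *: quot_proj (tq_ideal n q) a.
Proof.
rewrite -linearZ /=; apply/quot_projP.
have /factor_theorem[r pr] : root (p - p.[q]%:P) q.
  by rewrite rootE !hornerE subrr.
by exists (r *: a); rewrite scalerA mulrC -pr scalerBl.
Qed.

Lemma specA_generated : generated_by (@specA_gen k n q).
Proof.
move=> P PC PD PM Pgen x; have [a ->] := quot_proj_surj x.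
have Pa (b : genericA k n) : P (quot_proj (tq_ideal n q) b).
  elim/weyl_pres_generated: b => [p|b b' Pb Pb'|b b' Pb Pb'|i].
  - by rewrite specA_projZ rmorph1; apply: PC.
  - by rewrite [quot_proj _ _]rmorphD; apply: PD.
  - by rewrite [quot_proj _ _]rmorphM; apply: PM.
  - exact: Pgen.
exact: Pa.
Qed.

Lemma specA_relations : weyl_relations q (@specA_gen k n q).
Proof.
move=> i j lt_ij; pose pr := quot_proj (tq_ideal n q).
transitivity (pr (if conjugate_pair i j then ('X : {poly k})%:A else 0)).
  by rewrite -weyl_pres_relations // [RHS]rmorph_commutator.
case: ifP => _; last exact: rmorph0.
by rewrite [LHS]specA_projZ hornerX rmorph1.
Qed.

Lemma specA_to_weyl_pres :
  exists g : {lrmorphism specA n q -> weyl_pres q n},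
    forall i, g (specA_gen q i) = weyl_pres_gen q i.
Proof.
have rel_q : weyl_relations (horner_eval q 'X) (@weyl_pres_gen k q n).
  by rewrite /horner_eval hornerX; apply: weyl_pres_relations.
(* The map out of [A_n] induced by [t := q]; it is semilinear along evaluation at [q]. *)
pose ev := quot_lift (weyl_relations_ideal rel_q).
have evZ p (a : genericA k n) : ev (p *: a) = p.[q] *: ev a.
  have [b ->] := quot_proj_surj a.
  by rewrite -linearZ /ev !quot_liftE /= free_evalZ.
(* Seen on [A_n] with scalars restricted to [k], the same map is [k]-linear and kills the multiples
   of [t - q]. *)
pose ev' : {rmorphism genericA_k k n -> weyl_pres q n} := ev.
have [||g gE] := @quot_lift_alg k (genericA_k k n) _ (tq_ideal n q) ev'.
- move=> c a; rewrite -[c *: a]/(c%:P *: (a : genericA k n)).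
  by rewrite [LHS]evZ hornerC.
- by move=> _ [b ->]; rewrite [LHS]evZ !hornerE subrr scale0r.
exists g => i; rewrite gE [LHS]quot_liftE; exact: free_eval_gen.
Qed.

Lemma specA_weyl_pres_iso :
  exists (f : {lrmorphism weyl_pres q n -> specA n q})
    (g : {lrmorphism specA n q -> weyl_pres q n}),
    [/\ cancel f g, cancel g f,
      forall i, f (weyl_pres_gen q i) = specA_gen q i &
      forall i, g (specA_gen q i) = weyl_pres_gen q i].
Proof.
have [f fE] := weyl_pres_universal specA_relations.
have [g gE] := specA_to_weyl_pres; exists f, g.
have [fK gK] := generated_by_iso
  (@weyl_pres_generated k q n) specA_generated fE gE.
by split.
Qed.

End SpecializationIso.

(** * Bases from spanning sets and dual functionals *)

Lemma scalar_eq0 (S : comNzRingType) (V : lmodType S) (d : V -> S) :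
  scalar d -> d 0 = 0.
Proof.
by move=> d_lin; have := d_lin (-1) 0 0; rewrite scaler0 addr0 mulN1r addNr.
Qed.

Section SpanAndDual.
Variables (S : comNzRingType) (V : lmodType S) (I : eqType).
Implicit Type b : I -> V.

(** The list may repeat an index, so that sums of combinations are mere concatenations. *)
Definition in_span b (v : V) : Prop :=
  exists l : seq (S * I), v = \sum_(x <- l) x.1 *: b x.2.

Lemma in_spanD b u v : in_span b u -> in_span b v -> in_span b (u + v).
Proof. by move=> [l ->] [l' ->]; exists (l ++ l'); rewrite big_cat. Qed.

Lemma in_spanZ b c i : in_span b (c *: b i).
Proof. by exists [:: (c, i)]; rewrite big_seq1. Qed.

Lemma in_span_sum b (J : eqType) (r : seq J) (F : J -> V) :
  (forall j, j \in r -> in_span b (F j)) -> in_span b (\sum_(j <- r) F j).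
Proof.
move=> bF; rewrite big_seq; apply: (big_ind (in_span b)) => //.
  by exists [::]; rewrite big_nil.
by move=> u v; apply: in_spanD.
Qed.

Lemma dual_is_basis b :
  (forall i, exists2 d : V -> S, scalar d & forall j, d (b j) = (i == j)%:R) ->
  (forall v, in_span b v) -> is_basis b.
Proof.
move=> dual_b span_b; split=> [s a s_uniq sum0 i s_i|v].
  have [d d_lin d_b] := dual_b i.
  have d0 := scalar_eq0 d_lin.
  have dsum r : d (\sum_(j <- r) a j *: b j) = \sum_(j <- r) a j * (i == j)%:R.
    by elim: r => [|j r IHr]; rewrite ?big_nil // !big_cons d_lin IHr d_b.
  have := dsum s; rewrite sum0 d0 (bigD1_seq i) //= eqxx mulr1 big1 ?addr0 //.
  by move=> j /negPf; rewrite eq_sym => ->; rewrite mulr0.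
have [l ->] := span_b v.
(* Coefficients of repeated indices are added up, which yields a coefficient function on distinct
   indices. *)
exists (undup (unzip2 l)), (fun i => \sum_(x <- l | x.2 == i) x.1).
under [RHS]eq_bigr do rewrite scaler_suml.
rewrite (exchange_big_dep predT) //= big_seq [RHS]big_seq.
apply: eq_bigr => x l_x; rewrite big_mkcond /=.
rewrite (bigD1_seq x.2) ?undup_uniq ?mem_undup ?map_f //=.
by rewrite eqxx big1 ?addr0 // => j /negPf; rewrite eq_sym => ->.
Qed.

End SpanAndDual.

Lemma is_basis_iso (S : comNzRingType) (U V : lmodType S) (I : eqType)
    (f : {linear U -> V}) (b : I -> U) (b' : I -> V) :
  bijective f -> (forall i, f (b i) = b' i) -> is_basis b -> is_basis b'.
Proof.
move=> [g fK gK] fb [free_b span_b]; split=> [s a s_uniq sum0|v].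
  apply: free_b => //; apply: (can_inj fK).
  rewrite raddf0 raddf_sum -[RHS]sum0; apply: eq_bigr => i _.
  by rewrite /= linearZ /= fb.
have [s [a gv]] := span_b (g v); exists s, a.
rewrite -[LHS]gK gv raddf_sum; apply: eq_bigr => i _.
by rewrite /= linearZ /= fb.
Qed.

(** * Standard monomials along a skew polynomial extension *)

Lemma standard_monomial_morph (R R' : nzRingType) (f : {rmorphism R -> R'})
    (m : nat) (x : 'I_m -> R) (y : 'I_m -> R') :
  (forall i, f (x i) = y i) ->
  forall w, f (standard_monomial x w) = standard_monomial y w.
Proof. by move=> fx w; rewrite rmorph_prod; apply: eq_bigr => i _. Qed.

(** Letters are naturals rather than ordinals, so a word on [m] letters is also one on [m.+1]
    letters without reindexing. *)
Definition standard_nat_word (m : nat) (w : seq nat) : bool :=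
  sorted leq w && all (gtn m) w.

(** Sortedness pushes all occurrences of the largest letter [m] into a final block, which will
    become the power of the new variable. *)
Lemma standard_nat_wordS m w : standard_nat_word m.+1 w ->
  exists u e, standard_nat_word m u /\ w = u ++ nseq e m.
Proof.
rewrite /standard_nat_word; elim: w => [|x w IHw]; first by exists [::], 0%N.
move=> /andP[/= le_xw /andP[lt_x lt_w]].
have [|u [e [/andP[u_sorted lt_u] def_w]]] := IHw.
  by rewrite (path_sorted le_xw) lt_w.
move: lt_x; rewrite ltnS leq_eqVlt => /orP[/eqP def_x|lt_x].
  exists [::], e.+1; rewrite def_x def_w /=; split=> //.
  (* A letter below [m] cannot follow the head [m] in a sorted word, so [u] is empty. *)
  case: u {u_sorted} lt_u def_w => //= y u /andP[lt_y _] def_w.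
  by move: le_xw; rewrite def_x def_w /= leqNgt lt_y.
exists (x :: u), e; rewrite def_w /= lt_x lt_u; split=> //.
by move: le_xw; rewrite def_w cat_path => /andP[->].
Qed.

(** As [m] does not occur in [u] or [v], the exponent is recovered by counting [m]; the prefixes
    then have equal length. *)
Lemma cat_nseq_eq m u v e f : all (gtn m) u -> all (gtn m) v ->
  (u ++ nseq e m == v ++ nseq f m) = (u == v) && (e == f).
Proof.
move=> lt_u lt_v; apply/eqP/andP => [eq_w|[/eqP-> /eqP->] //].
have count0 w : all (gtn m) w -> count_mem m w = 0%N.
  by move=> /allP lt_w; apply/count_memPn/negP => /lt_w /=; rewrite ltnn.
have ef : e = f.
  have := congr1 (count_mem m) eq_w.
  by rewrite !count_cat !count_nseq /= eqxx !mul1n !count0.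
have size_uv : size u = size v.
  apply: (@addIn f).
  by have := congr1 size eq_w; rewrite !size_cat !size_nseq ef.
by move/eqP: eq_w; rewrite eqseq_cat // ef eqxx => /andP[].
Qed.

Definition nat_monomial (R : nzRingType) (y : nat -> R) (w : seq nat) : R :=
  \prod_(i <- w) y i.

(** Linear independence in the stronger form of coordinate functionals, which pass easily from [R]
    to [R[z; nu]]. *)
Definition standard_dual (S : comNzRingType) (R : algType S) (m : nat)
    (y : nat -> R) : Prop :=
  forall w, standard_nat_word m w ->
  exists2 d : R -> S, scalar d &
    forall v, standard_nat_word m v -> d (nat_monomial y v) = (w == v)%:R.

Definition standard_span (S : comNzRingType) (R : algType S) (m : nat)
    (y : nat -> R) : Prop :=
  forall a : R, in_span
    (fun w : {w | standard_nat_word m w} => nat_monomial y (sval w)) a.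

Section SkewStep.
Variables (S : comNzRingType) (R : algType S) (nu : derivation R) (m : nat).
Variables (y : nat -> R) (z : nat -> skew_poly nu).
Hypotheses (zm : z m = skew_var nu)
  (zlt : forall i, (i < m)%N -> z i = skew_const nu (y i)).

Lemma skew_monomialE (a : R) e :
  skew_const nu a * skew_var nu ^+ e = (a *: 'X^e : {poly R}).
Proof.
have -> : skew_var nu ^+ e = ('X^e : {poly R}).
  elim: e => // e IHe; rewrite exprS IHe.
  by rewrite -[LHS]/(skew_mul nu 'X 'X^e) skew_mulX skew_varmulXn.
by rewrite -[LHS]/(skew_mul nu a%:P 'X^e) skew_mulC.
Qed.

Lemma nat_monomial_step u e : all (gtn m) u ->
  nat_monomial z (u ++ nseq e m)
  = skew_const nu (nat_monomial y u) * skew_var nu ^+ e.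
Proof.
move=> /allP lt_u; rewrite /nat_monomial big_cat /= rmorph_prod; congr (_ * _).
  by rewrite [LHS]big_seq [RHS]big_seq; apply: eq_bigr => i /lt_u; apply: zlt.
by rewrite big_nseq zm -Monoid.iteropE; elim: e.
Qed.

(** The functional for a word [u] followed by [e] letters [m] takes the coefficient of [z^e] and
    applies the functional of [u]. *)
Lemma standard_dual_skew : standard_dual m y -> standard_dual m.+1 z.
Proof.
move=> dual_y w /standard_nat_wordS[u [e [u_std ->]]].
have [d d_lin dE] := dual_y u u_std.
exists (fun p : skew_poly nu => d (p : {poly R})`_e) => [c p p'|v].
  rewrite -[c *: p]/(c%:A *: (p : {poly R})) [X in d X]coefD coefZ mulr_algl.
  exact: d_lin.
move=> /standard_nat_wordS[u' [f [u'_std ->]]].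
have [/andP[_ lt_u] /andP[_ lt_u']] := (u_std, u'_std).
rewrite nat_monomial_step // skew_monomialE coefZ coefXn cat_nseq_eq //.
case: eqP => _; first by rewrite mulr1 dE // andbT.
by rewrite mulr0 andbF (scalar_eq0 d_lin).
Qed.

Lemma standard_span_skew : standard_span m y -> standard_span m.+1 z.
Proof.
move=> span_y p; rewrite (skew_poly_expand p).
apply: in_span_sum => i _; have [l ->] := span_y (p : {poly R})`_i.
rewrite raddf_sum mulr_suml; apply: in_span_sum => -[c [u u_std]] _ /=.
have /andP[u_sorted lt_u] := u_std.
have w_std : standard_nat_word m.+1 (u ++ nseq i m).
  rewrite /standard_nat_word all_cat all_nseq /= ltnSn orbT andbT.
  apply/andP; split; last by apply: sub_all lt_u => j; apply: ltnW.
  (* Appending copies of [m] keeps the word sorted, all letters of [u] being smaller; the pairwise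
     form splits over concatenation. *)
  rewrite (sorted_pairwise leq_trans) pairwise_cat -(sorted_pairwise leq_trans).
  rewrite u_sorted andTb; apply/andP; split.
    by apply/allrelP => j j' /(allP lt_u) /ltnW /= le_j /nseqP[-> _].
  by elim: (i : nat) => //= e ->; rewrite all_nseq leqnn orbT.
rewrite linearZ /= -scalerAl -nat_monomial_step //.
pose b (w : {w | standard_nat_word m.+1 w}) := nat_monomial z (sval w).
exact: (in_spanZ b c
  (exist (fun w => is_true (standard_nat_word m.+1 w)) _ w_std)).
Qed.

End SkewStep.

Definition StandardWord (m : nat) (w : seq 'I_m)
    (w_std : sorted (fun i j : 'I_m => i <= j)%N w) : standard_word m :=
  exist (fun v => is_true (sorted (fun i j : 'I_m => i <= j)%N v)) w w_std.

Lemma standard_is_basis (S : comNzRingType) (R : algType S) (m : nat)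
    (y : nat -> R) :
  standard_dual m y -> standard_span m y ->
  is_basis (standard_monomial (fun i : 'I_m => y i)).
Proof.
move=> dual_y span_y.
have monE (w : standard_word m) :
    standard_monomial (fun i : 'I_m => y i) w
    = nat_monomial y (map val (val w)).
  by rewrite /nat_monomial big_map.
have map_std (w : standard_word m) : standard_nat_word m (map val (val w)).
  rewrite /standard_nat_word sorted_map (valP w) /=.
  by apply/allP => _ /mapP[i _ ->]; apply: ltn_ord.
apply: dual_is_basis => [w|a].
  have [d d_lin dE] := dual_y _ (map_std w); exists d => // v.
  by rewrite monE dE // (inj_eq (inj_map val_inj)).
have [l ->] := span_y a; apply: in_span_sum => -[c [u u_std]] _ /=.
have [u_sorted lt_u] := andP u_std.
(* All letters of [u] are below [m], so the conversion to ordinals drops none of them. *)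
have val_u : map val (pmap insub u : seq 'I_m) = u.
  by rewrite pmap_filter; [apply/all_filterP; apply: sub_all lt_u => i;
    rewrite isSome_insub | apply: insubK].
have w_std : sorted (fun i j : 'I_m => i <= j)%N (pmap insub u : seq 'I_m).
  by move: u_sorted; rewrite -{1}val_u sorted_map.
have := in_spanZ (standard_monomial (fun i : 'I_m => y i)) c
  (StandardWord w_std).
by rewrite monE /= val_u.
Qed.

(** * Standard bases of the tower and of the presented algebra *)

Section TowerBasis.
Variables (S : comNzRingType) (q : S).

Let z_lt (R : Type) (m i : nat) (a b : R) :
  (i < m)%N -> (if i == m then a else b) = b.
Proof. by move=> lt_i; rewrite ltn_eqF. Qed.

Lemma standard_nat_word0 w : standard_nat_word 0 w -> w = [::].
Proof. by case: w => // i w /andP[_ /=]. Qed.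

Lemma weyl_tower_standard_dual n : standard_dual n.*2 (weyl_tower_gen q n).
Proof.
elim: n => [|n IHn].
  (* The bottom of the tower is [S] itself, and the empty word is its only standard word. *)
  move=> w /standard_nat_word0->; exists id => // v /standard_nat_word0->.
  by rewrite /nat_monomial big_nil.
have odd_dual : standard_dual n.*2.+1 (odd_tower_gen q n).
  apply: (@standard_dual_skew _ _ _ _ (weyl_tower_gen q n)) IHn => [|i lt_i].
    by rewrite /odd_tower_gen eqxx.
  by rewrite /odd_tower_gen z_lt.
rewrite doubleS.
apply: (@standard_dual_skew _ _ (tower_derivation q n)) odd_dual.
  by rewrite weyl_tower_genS eqxx.
by move=> i lt_i; rewrite weyl_tower_genS z_lt.
Qed.

Lemma weyl_tower_standard_span n : standard_span n.*2 (weyl_tower_gen q n).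
Proof.
elim: n => [|n IHn].
  move=> a; pose b (w : {w | standard_nat_word 0 w}) :=
    nat_monomial (weyl_tower_gen q 0) (sval w).
  have := in_spanZ b a
    (exist (fun w => is_true (standard_nat_word 0 w)) [::] isT).
  by rewrite /b /nat_monomial big_nil; congr in_span; apply: mulr1.
have odd_span : standard_span n.*2.+1 (odd_tower_gen q n).
  apply: (@standard_span_skew _ _ _ _ (weyl_tower_gen q n)) IHn => [|i lt_i].
    by rewrite /odd_tower_gen eqxx.
  by rewrite /odd_tower_gen z_lt.
rewrite doubleS.
apply: (@standard_span_skew _ _ (tower_derivation q n)) odd_span.
  by rewrite weyl_tower_genS eqxx.
by move=> i lt_i; rewrite weyl_tower_genS z_lt.
Qed.

End TowerBasis.

(** The basis of the tower is carried over by the isomorphism. As [S] and [c] are arbitrary, this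
    covers [A_n] over [k[t]] with [c = t] as well as [W_n]. *)
Lemma weyl_pres_is_basis (S : comNzRingType) (c : S) (n : nat) :
  is_basis (standard_monomial (@weyl_pres_gen S c n)).
Proof.
have [f [g [fK gK fE]]] := weyl_pres_tower_iso c n.
apply: (is_basis_iso (f := g) (Bijective gK fK)
  (b := standard_monomial (fun i : 'I_n.*2 => weyl_tower_gen c n i))).
  by apply: (standard_monomial_morph (f := g)) => i; rewrite -fE; apply: fK.
apply: standard_is_basis; first exact: weyl_tower_standard_dual.
exact: weyl_tower_standard_span.
Qed.

(** * Standard monomials in the commutative polynomial algebra *)

Section PolynomialBasis.
Variables (k : comNzRingType) (m : nat).

Let exponent (w : seq 'I_m) : 'X_{1.. m} := (\sum_(i <- w) U_(i))%MM.

Let exponentE w i : exponent w i = count_mem i w.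
Proof.
rewrite /exponent mnm_sumE; elim: w => [|j w IHw]; first by rewrite big_nil.
by rewrite big_cons IHw mnm1E.
Qed.

Lemma mpoly_standard_is_basis :
  @is_basis k (mpoly m k) _ (standard_monomial (fun i : 'I_m => 'X_i)).
Proof.
have monE (w : standard_word m) :
    standard_monomial (fun i : 'I_m => 'X_i : (mpoly m k)) w
    = 'X_[exponent (val w)].
  rewrite /standard_monomial /exponent.
  elim: (val w) => [|i s IHs]; first by rewrite !big_nil mpolyX0.
  by rewrite !big_cons mpolyXD IHs.
have le_trans : transitive (fun i j : 'I_m => i <= j)%N.
  by move=> i j l; apply: leq_trans.
have le_anti : antisymmetric (fun i j : 'I_m => i <= j)%N.
  by move=> i j le_ij; apply/val_inj/anti_leq.
have le_total : total (fun i j : 'I_m => i <= j)%N.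
  by move=> i j; apply: leq_total.
apply: dual_is_basis => [w|p].
  exists (mcoeff (exponent (val w))) => [c p p'|v].
    by rewrite mcoeffD mcoeffZ.
  rewrite monE mcoeffX; congr (nat_of_bool _)%:R.
  (* Equal exponents mean equal letter counts, and sorted words that are permutations of each other
     coincide. *)
  apply/eqP/eqP => [eq_wv|-> //]; apply/val_inj.
  apply: (sorted_eq le_trans le_anti (valP w) (valP v)).
  by apply/allP => i _ /=; rewrite -!exponentE eq_wv.
rewrite (mpolyE p); apply: in_span_sum => e _.
have [s ->] : exists s : seq 'I_m, e = exponent s.
  (* The word repeats each letter [i] exactly [e i] times; it is sorted afterwards, which leaves the
     counts unchanged. *)
  exists (flatten [seq nseq (e i) i | i <- enum 'I_m]).
  apply/mnmP => i; rewrite exponentE count_flatten -map_comp.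
  rewrite sumnE big_map big_enum /= (bigD1 i) //= count_nseq /= eqxx mul1n.
  by rewrite big1 ?addn0 // => j /negPf ne; rewrite count_nseq /= ne.
have := in_spanZ (standard_monomial (fun i : 'I_m => 'X_i)) p@_(exponent s)
  (StandardWord (sort_sorted le_total s)).
rewrite monE /=; congr (in_span _ (_ *: 'X_[_])).
by apply/mnmP => i; rewrite !exponentE; apply/permP; rewrite perm_sort.
Qed.

End PolynomialBasis.

Theorem proposition3p4 (k : closedFieldType) (char0 : [pchar k] =i pred0)
    (n : nat) (n_gt0 : (0 < n)%N) :
  (* (1) *)
  (forall q : k, q != 0 ->
    [/\ (* presentation of [A_q] *)
        exists f : {lrmorphism weyl_pres q n -> specA n q},
          bijective f /\ forall i, f (weyl_pres_gen q i) = specA_gen q i,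
        (* [A_q] as an iterated skew polynomial algebra *)
        exists g : {lrmorphism specA n q -> weyl_tower q n},
          bijective g /\
          forall i : 'I_n.*2, g (specA_gen q i) = weyl_tower_gen q n i &
        (* [tower_derivation q l] is the derivation of the stage below
           [x_{2(l+1)}] determined by its values on the generators *)
        forall l : nat, (l < n)%N ->
          (forall i : nat, (i <= l.*2)%N ->
             tower_derivation q l (odd_tower_gen q l i)
             = if i == l.*2 then q%:A else 0) /\
          (forall nu : derivation (odd_tower q l),
             (forall i : nat, (i <= l.*2)%N ->
                nu (odd_tower_gen q l i) = if i == l.*2 then q%:A else 0) ->
             nu =1 tower_derivation q l)]) /\
  (* (2) *)
  ((forall q : k, q != 0 ->
      exists f : {lrmorphism specA n q -> weyl k n}, bijective f) /\
   (exists f : {lrmorphism specA n (1 : k) -> weyl k n},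
      bijective f /\ forall i, f (specA_gen 1 i) = weyl_gen k i)) /\
  (* (3) *)
  [/\ @is_basis {poly k} (genericA k n) _ (standard_monomial (@genericA_gen k n)),
      forall q : k, q != 0 ->
        @is_basis k (specA n q) _ (standard_monomial (@specA_gen k n q)),
      @is_basis k (weyl k n) _ (standard_monomial (@weyl_gen k n)) &
      @is_basis k (poisson_weyl k n) _
        (standard_monomial (@poisson_weyl_gen k n))].
Proof.
split; [move=> q q0; split | split; [split | split]].
- have [f [g [fK gK fE _]]] := specA_weyl_pres_iso n q.
  by exists f; split; first exact: Bijective fK gK.
- have [f [g [fK gK _ gE]]] := specA_weyl_pres_iso n q.
  have [h [h' [hK h'K hE]]] := weyl_pres_tower_iso q n.
  exists (h \o g); split.
    exact: bij_comp (Bijective hK h'K) (Bijective gK fK).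
  by move=> i; rewrite -hE -gE.
- move=> l _; split=> [i _|nu nuE]; first exact: tower_derivation_gen.
  apply: (derivation_eq (@odd_tower_generated _ q l)) => i.
  by rewrite tower_derivation_gen nuE // -ltnS.
- move=> q q0; have [f [g [fK gK _ _]]] := specA_weyl_pres_iso n q.
  have [h h_bij] := weyl_pres_rescale n q0 (oner_neq0 k).
  by exists (h \o g); apply: bij_comp h_bij (Bijective gK fK).
(* [weyl k n] is [weyl_pres 1 n] by definition, so for [q = 1] the comparison map already preserves
   generators without rescaling. *)
- have [f [g [fK gK _ gE]]] := specA_weyl_pres_iso n (1 : k).
  by exists g; split; first exact: Bijective gK fK.
- exact: weyl_pres_is_basis.
- move=> q _; have [f [g [fK gK fE _]]] := specA_weyl_pres_iso n q.
  apply: (is_basis_iso (Bijective fK gK)) (weyl_pres_is_basis q n).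
  exact: standard_monomial_morph fE.
- exact: weyl_pres_is_basis.
- exact: mpoly_standard_is_basis.
Qed.
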